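(* Let $N=1$, $\Omega=\Omega^{\#}=(-1,1)$ and $f(x)=|x|$ for $x\in\Omega$, so that $f^{\#}(x)=1-|x|$. For every $s\in(0,1)$, let $u_s$ and $v_s$ be the solutions to $$(-\Delta)^s u_s=f\ \text{ in }(-1,1),\quad u_s=0\ \text{ on }\mathbb{R}\setminus(-1,1),\qquad (-\Delta)^s v_s=f^{\#}\ \text{ in }(-1,1),\quad v_s=0\ \text{ on }\mathbb{R}\setminus(-1,1).$$ Then, for every $s\in(0,1)$, the pointwise estimate $u_s^{\#}(x)\le v_s(x)$ does not hold true in $(-1,1)$, i.e. there exists $x\in(-1,1)$ such that $u_s^{\#}(x)>v_s(x)$.
   Context: For a measurable real function $g$ on $(-1,1)$ extended by zero to $\mathbb{R}$, let $\mu_g(t)=|\{x:|g(x)|>t\}|$; its Schwarz decreasing rearrangement is $g^{\#}(x)=\sup\{t\ge0:\mu_g(t)>2|x|\}$, $x\in(-1,1)$. The operator $(-\Delta)^s$ on $\mathbb{R}$ is $(-\Delta)^s w(x)=\gamma(1,s)\,\mathrm{P.V.}\int_{\mathbb{R}}\frac{w(x)-w(y)}{|x-y|^{1+2s}}dy$, with $\gamma(1,s)=\dfrac{s\,2^{2s}\,\Gamma\big(\frac{1+2s}{2}\big)}{\pi^{1/2}\,\Gamma(1-s)}$. The (weak) solution to $(-\Delta)^s w=g$ in $(-1,1)$, $w=0$ on $\mathbb{R}\setminus(-1,1)$, is the function $w\in H^s(\mathbb{R})$ with $\operatorname{supp} w\subset[-1,1]$ such that, for all $\varphi\in H^s(\mathbb{R})$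 with $\operatorname{supp}\varphi\subset[-1,1]$, $$\frac{\gamma(1,s)}{2}\int_{\mathbb{R}}\int_{\mathbb{R}}\frac{(w(x)-w(y))(\varphi(x)-\varphi(y))}{|x-y|^{1+2s}}\,dx\,dy=\int_{-1}^{1}g(x)\varphi(x)\,dx .$$ For the data $g=f$ and $g=f^{\#}$ considered here, the solutions are continuous on $\mathbb{R}$ and are identified with their continuous representatives. *)

(* Defs.v *)
From HB Require Import structures.
From mathcomp Require Import all_boot all_order all_algebra.
From mathcomp Require Import all_classical all_reals all_analysis.
Set Implicit Arguments.
Unset Strict Implicit.
Unset Printing Implicit Defensive.
Import Order.TTheory GRing.Theory Num.Theory.
Import numFieldNormedType.Exports.
Local Open Scope classical_set_scope.
Local Open Scope ring_scope.

Section Rearrangement.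
Context {R : realType}.
Implicit Types (g : R -> R) (t x : R).

(* [g \_ A] is [g] on [A] and 0 elsewhere: only the values of [g] on (-1, 1)
   matter here. *)
Definition distribution_fun g t : \bar R :=
  lebesgue_measure [set x | t < `|(g \_ `]-1, 1[) x| ].

(* Real-valued supremum: it is 0 for the empty set, as is the supremum taken in
   [0, +oo[.  It is only meaningful where the set is bounded, in particular for
   every [g] that is bounded on (-1, 1). *)
Definition schwarz g x : R :=
  sup [set t | 0 <= t /\ ((2 * `|x|)%:E < distribution_fun g t)%E].

End Rearrangement.

Section FractionalLaplacian.
Context {R : realType}.
Implicit Types (s : R) (w phi g : R -> R).

Definition euler_Gamma (z : R) : R :=
  fine (\int[lebesgue_measure]_(t in `]0%R, +oo[) (t `^ (z - 1) * expR (- t))%:E)%E.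

Definition gamma_const s : R :=
  s * 2 `^ (2 * s) * euler_Gamma ((1 + 2 * s) / 2)
  / (pi `^ (1 / 2) * euler_Gamma (1 - s)).

(* On the diagonal, a null set of the plane, the quotients below are 0 / 0 = 0. *)
Definition gagliardo s w : \bar R :=
  (\int[lebesgue_measure \x lebesgue_measure]_z
    ((w z.1 - w z.2) ^+ 2 / `|z.1 - z.2| `^ (1 + 2 * s))%:E)%E.

(* Functions, not classes: they are Borel measurable, and every class modulo
   almost everywhere equality has such a representative. *)
Definition Hs s : set (R -> R) :=
  [set w | w \in Lfun (@lebesgue_measure R) 2%:E /\ (gagliardo s w < +oo)%E].

(* The support of a function defined up to a null set: the complement of the
   largest open set on which it vanishes almost everywhere. *)
Definition supp w : set R :=
  ~` \bigcup_(U in [set U | open U /\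
        {ae lebesgue_measure, forall x, U x -> w x = 0}]) U.

Definition fraclap_form s w phi : \bar R :=
  ((gamma_const s / 2)%:E *
   \int[lebesgue_measure \x lebesgue_measure]_z
    ((w z.1 - w z.2) * (phi z.1 - phi z.2)
       / `|z.1 - z.2| `^ (1 + 2 * s))%:E)%E.

Definition weak_solution s g w :=
  [/\ Hs s w, supp w `<=` `[-1, 1] &
   forall phi, Hs s phi -> supp phi `<=` `[-1, 1] ->
     fraclap_form s w phi =
     (\int[lebesgue_measure]_(x in `](-1)%R, 1%R[) (g x * phi x)%:E)%E].

End FractionalLaplacian.

(* Main.v *)
Require Import Defs.
From HB Require Import structures.
From mathcomp Require Import all_boot all_order all_algebra.
From mathcomp Require Import all_classical all_reals all_analysis.
From mathcomp Require Import measurable_realfun ring lra.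
Import Order.TTheory GRing.Theory Num.Theory.
Import numFieldNormedType.Exports.
Local Open Scope classical_set_scope.
Local Open Scope ring_scope.
Set Implicit Arguments.
Unset Strict Implicit.
Unset Printing Implicit Defensive.

(** Suppose that the rearrangement of [u] is below [v] on (-1, 1).  The contradiction comes
    from the behaviour of [u] and [v] near the end points, where the solution with data [f]
    is comparable to the distance to the boundary to the power [s], with a coefficient
    proportional to the integral of [f x * (1 - x ^+ 2) ^ (s - 1)].  The weight is largest near
    the end points, which favours the data [`|x|] over [1 - `|x|], so that [u] has the larger
    coefficient; and rearranging [u] does not lower it there to leading order.

    This is made rigorous without boundary asymptotics, by dilations.  As [`|x|] is
    homogeneous, the maximum principle gives [`|l| ^ (1 + 2 * s) * u x <= u (l * x)] for
    [`|l| <= 1] ([dilation_le]).  Hence [u] is even and nearly decreasing in [`|x|], its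
    rearrangement is at least [c * u] near the boundary for every [c < 1], and therefore
    [c * u <= v] outside some interval (-r, r) ([near_boundary]).

    Both equations are tested with the torsion function [T x = (1 - x ^+ 2) ^ s], whose
    fractional Laplacian is constant in (-1, 1) ([form_torsion]).  The proof of this fact
    truncates the singular integral along pseudo-hyperbolic neighbourhoods of the diagonal:
    after a Moebius substitution the truncated integrals are explicit ([far_kern],
    [far_torsion]) and converge to a constant ([trunc_op_bounds]).  Consequently the change of
    the energy form of [w] and [T] when [w x] is replaced by [w (r * x)] depends only on the
    values of [w] outside (-r, r), and is monotone in them ([flux], [fluxE], [flux_le]).  For
    [w] equal to [u] or [v] the same change is determined by the equation, through the
    moments [m0] of [T] and [m1] of [`|x| * T x] ([flux_distance], [flux_codistance]).

    As [r] and [c] tend to 1 the comparison of the two changes reads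
    [4 <= (1 + 2 * s) * m0].  The opposite strict inequality holds ([moment0_lt]), by the
    Bernoulli inequality. *)

(** * Dilations of the line and of the plane *)

Section dilation.
Context {R : realType}.
Local Notation mu := (@lebesgue_measure R).
Local Notation mu2 := (mu \x mu)%E.

(** The measure scaled by [`|l|] of the preimages under [x |-> l * x] gives the
    half-open intervals their length, and Lebesgue measure is the only such one. *)
Lemma lebesgue_measure_dilation (l : R) (A : set R) : l != 0 -> measurable A ->
  (`|l|%:E * mu (( *%R l : measurableTypeR R -> measurableTypeR R) @^-1` A) = mu A)%E.
Proof.
move=> l0 mA.
have nl : (0 <= `|l|) by [].
pose phi : measurableTypeR R -> measurableTypeR R := *%R l.
have mphi : measurable_fun setT phi by apply: measurable_funM => //; exact: measurable_cst.
pose pm : {measure set (measurableTypeR R) -> \bar R} :=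
  measure_function_pushforward__canonical__measure_function_Measure mu mphi.
pose m : {measure set (measurableTypeR R) -> \bar R} := mscale (NngNum nl) pm.
apply/esym; apply: (@lebesgue_measure_unique R m) => // _ [[a b]] _ <-.
rewrite /=; transitivity (`|l|%:E * mu (phi @^-1` `]a, b]))%E; last by [].
have [lp|ln|/eqP] := ltgtP 0 l; last by rewrite eq_sym (negbTE l0).
- have -> : phi @^-1` `]a, b] = `](a / l), (b / l)]%classic.
    by apply/seteqP; split => x /=; rewrite /phi !in_itv/= ltr_pdivrMr// ler_pdivlMr// (mulrC x).
  rewrite !lebesgue_measure_itv/= !lte_fin ltr_pM2r ?invr_gt0//.
  case: ifPn => // _; last by rewrite mule0.
  by rewrite -!EFinB -EFinM gtr0_norm// mulrBr ![l * (_ / _)]mulrC !divfK.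
- have -> : phi @^-1` `]a, b] = `[(b / l), (a / l)[%classic.
    by apply/seteqP; split => x /=; rewrite /phi !in_itv/= ltr_ndivlMr// ler_ndivrMr// (mulrC x) andbC.
  rewrite !lebesgue_measure_itv/= !lte_fin ltr_nM2r ?invr_lt0//.
  case: ifPn => // _; last by rewrite mule0.
  rewrite -!EFinB -EFinM ltr0_norm// mulrBr !mulNr ![l * (_ / _)]mulrC !divfK//.
  by rewrite opprK addrC.
Qed.

Local Open Scope ereal_scope.

Lemma ge0_integral_dilation (l : R) (f : R -> \bar R) : l != 0%R ->
  measurable_fun setT f -> (forall x, 0 <= f x) ->
  \int[mu]_x f x = `|l|%:E * \int[mu]_x f (l * x)%R.
Proof.
move=> l0 mf f0.
have nl : (0 <= `|l|)%R by [].
pose phi : measurableTypeR R -> measurableTypeR R := *%R l.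
have mphi : measurable_fun setT phi by apply: measurable_funM => //; exact: measurable_cst.
pose pm : {measure set (measurableTypeR R) -> \bar R} :=
  measure_function_pushforward__canonical__measure_function_Measure mu mphi.
pose m : {measure set (measurableTypeR R) -> \bar R} := mscale (NngNum nl) pm.
transitivity (\int[m]_x f x).
  apply: eq_measure_integral => A mA _.
  exact/esym/lebesgue_measure_dilation.
transitivity (`|l|%:E * \int[pm]_x f x); first exact: ge0_integral_mscale.
by congr (_ * _); exact: (@ge0_integral_pushforward _ _ _ _ _ phi).
Qed.

(** The plane carries the product of two copies of Lebesgue measure; fixing the
    measures here keeps unification from looking for them in later uses. *)
Lemma tonelli1 (f : R * R -> \bar R) : measurable_fun setT f ->
  (forall z, 0 <= f z) -> \int[mu2]_z f z = \int[mu]_x \int[mu]_y f (x, y).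
Proof. exact: (@fubini_tonelli1 _ _ _ _ _ mu mu). Qed.

Lemma tonelli2 (f : R * R -> \bar R) : measurable_fun setT f ->
  (forall z, 0 <= f z) -> \int[mu2]_z f z = \int[mu]_y \int[mu]_x f (x, y).
Proof. exact: (@fubini_tonelli2 _ _ _ _ _ mu mu). Qed.

Lemma measurable_tonelli1 (f : R * R -> \bar R) : measurable_fun setT f ->
  (forall z, 0 <= f z) ->
  measurable_fun setT (fun x : R => \int[mu]_y f (x, y)).
Proof. exact: (@measurable_fun_fubini_tonelli_F _ _ _ _ _ mu). Qed.

Lemma ge0_integral2_dilation (l : R) (f : R * R -> \bar R) : l != 0%R ->
  measurable_fun setT f -> (forall x, 0 <= f x) ->
  \int[mu2]_z f z = (`|l| ^+ 2)%:E * \int[mu2]_z f (l * z.1, l * z.2)%R.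
Proof.
move=> l0 mf f0.
have ml : measurable_fun setT (fun z : R * R => (l * z.1, l * z.2)%R).
  by apply/measurable_fun_pairP; split; apply: measurable_funM => //.
have mg : measurable_fun setT (fun z : R * R => f (l * z.1, l * z.2)%R).
  exact: (measurableT_comp mf ml).
rewrite !tonelli1//.
rewrite (ge0_integral_dilation l0); last 2 first.
- exact: (measurable_tonelli1 (f := f)).
- by move=> x; apply: integral_ge0.
rewrite expr2 EFinM -muleA; congr (_ * _).
rewrite -ge0_integralZl//; last 2 first.
- exact: (measurable_tonelli1 (f := fun z : R * R => f (l * z.1, l * z.2)%R)).
- by move=> x _; apply: integral_ge0.
apply: eq_integral => x _; rewrite (ge0_integral_dilation l0)//.
by apply: measurableT_comp.
Qed.

Lemma ge0_pmuleBr (r : R) (A B : \bar R) : (0 < r)%R -> 0 <= A -> 0 <= B ->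
  r%:E * (A - B) = r%:E * A - r%:E * B.
Proof.
move=> r0; case: A => [a| |]//= _; case: B => [b| |]//= _.
- by rewrite -EFinB -!EFinM -EFinB mulrBr.
- by rewrite !gt0_muleNy ?gt0_muley ?lte_fin.
- by rewrite !gt0_muley ?lte_fin.
- by rewrite !gt0_muley ?gt0_muleNy ?lte_fin.
Qed.

(** The extended integrals of the positive and the negative part scale separately,
    and so does their difference, whichever of them are infinite. *)
Lemma integral2_dilation (l : R) (f : R * R -> \bar R) : l != 0%R ->
  measurable_fun setT f ->
  \int[mu2]_z f (l * z.1, l * z.2)%R = (`|l| ^- 2)%:E * \int[mu2]_z f z.
Proof.
move=> l0 mf.
have l1 : (`|l| ^- 2)%R%:E * (`|l| ^+ 2)%:E = 1 :> \bar R.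
  by rewrite -EFinM mulVf// expf_neq0// normr_eq0.
rewrite [in LHS]integralE [in RHS]integralE.
rewrite [in RHS](@ge0_integral2_dilation l f^\+)//; last exact: measurable_funepos.
rewrite [in RHS](@ge0_integral2_dilation l f^\-)//; last exact: measurable_funeneg.
set A := \int[_]_z f^\+ _; set B := \int[_]_z f^\- _.
rewrite -[LHS]mul1e -l1 -muleA; congr (_ * _).
transitivity ((`|l| ^+ 2)%:E * (A - B)).
  congr (_ * (_ - _)); apply: eq_integral => z _.
  - by rewrite !funeposE.
  - by rewrite !funenegE.
rewrite ge0_pmuleBr//; [by rewrite exprn_gt0// normr_gt0|exact: integral_ge0..].
Qed.

Lemma integral_dilation (l : R) (f : R -> \bar R) : l != 0%R ->
  measurable_fun setT f ->
  \int[mu]_x f x = `|l|%:E * \int[mu]_x f (l * x)%R.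
Proof.
move=> l0 mf; rewrite [in LHS]integralE [in RHS]integralE.
rewrite (ge0_integral_dilation l0 (f := f^\+))//; last exact: measurable_funepos.
rewrite (ge0_integral_dilation l0 (f := f^\-))//; last exact: measurable_funeneg.
rewrite -ge0_pmuleBr ?normr_gt0//; [|exact: integral_ge0..].
congr (_ * (_ - _)); apply: eq_integral => z _.
- by rewrite !funeposE.
- by rewrite !funenegE.
Qed.

End dilation.

(** * The energy form on continuous functions *)

Section energy_form.
Context {R : realType}.
Local Notation mu := (@lebesgue_measure R).
Local Notation mu2 := (mu \x mu)%E.
Implicit Types (s b c : R) (w phi psi : R -> R) (z : R * R).

Definition kern s z : R := `|z.1 - z.2| `^ (- (1 + 2 * s)).

Definition dform s w phi z : R :=
  (w z.1 - w z.2) * (phi z.1 - phi z.2) * kern s z.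

Definition form s w phi : R := \int[mu2]_z dform s w phi z.

(** Only continuous functions are tested against, so that vanishing outside an
    interval and inequalities hold at every point.  The bound [b] on the support
    is a parameter because dilations change it. *)
Definition energy_space s b : set (R -> R) :=
  [set w | [/\ continuous w, forall x, b <= `|x| -> w x = 0 &
                 (gagliardo s w < +oo)%E]].

Lemma kern_ge0 s z : 0 <= kern s z.
Proof. exact: powR_ge0. Qed.

Lemma kern_sym s x y : kern s (x, y) = kern s (y, x).
Proof. by rewrite /kern/= distrC. Qed.

Lemma measurable_kern s : measurable_fun setT (kern s).
Proof.
rewrite /kern; apply: (measurableT_comp (@measurable_powR R _)) => //.
apply: measurableT_comp => //.
exact: measurable_funB.
Qed.

Lemma measurable_proj1 w : measurable_fun setT w ->
  measurable_fun setT (fun z : R * R => w z.1).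
Proof. by move=> mw; apply: (measurableT_comp mw). Qed.

Lemma measurable_proj2 w : measurable_fun setT w ->
  measurable_fun setT (fun z : R * R => w z.2).
Proof. by move=> mw; apply: (measurableT_comp mw). Qed.

Lemma measurable_dform s w phi : measurable_fun setT w ->
  measurable_fun setT phi -> measurable_fun setT (dform s w phi).
Proof.
move=> mw mphi; apply: measurable_funM; last exact: measurable_kern.
by apply: measurable_funM; apply: measurable_funB;
  (exact: measurable_proj1 || exact: measurable_proj2).
Qed.

Lemma continuous_measurable w : continuous w -> measurable_fun setT w.
Proof. exact: continuous_measurable_fun. Qed.

Lemma dform_ge0 s w z : 0 <= dform s w w z.
Proof. by rewrite mulr_ge0 ?kern_ge0// -expr2 sqr_ge0. Qed.

Lemma gagliardoE s w : gagliardo s w = (\int[mu2]_z (dform s w w z)%:E)%E.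
Proof.
by apply: eq_integral => z _; rewrite /dform -expr2 /kern powRN.
Qed.

Lemma energy_measurable s b w : energy_space s b w -> measurable_fun setT w.
Proof. by case=> cw _ _; exact: continuous_measurable. Qed.

Lemma energy_integrable s b w : energy_space s b w ->
  mu2.-integrable setT (fun z => (dform s w w z)%:E).
Proof.
move=> ew; apply/integrableP; split.
  apply/measurable_EFinP; apply: measurable_dform; exact: (energy_measurable ew).
case: ew => _ _; rewrite gagliardoE; apply: le_lt_trans.
rewrite le_eqVlt; apply/orP; left; apply/eqP.
by apply: eq_integral => z _; rewrite gee0_abs// lee_fin dform_ge0.
Qed.

Lemma le_integrable_fin (f g : R * R -> R) : measurable_fun setT f ->
  (forall z, `|f z| <= g z) -> mu2.-integrable setT (fun z => (g z)%:E) ->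
  mu2.-integrable setT (fun z => (f z)%:E).
Proof.
move=> mf fg; apply: le_integrable => //; first exact/measurable_EFinP.
by move=> z _ /=; rewrite lee_fin (le_trans (fg z))// ler_norm.
Qed.

Lemma dform_le s w phi z :
  `|dform s w phi z| <= dform s w w z + dform s phi phi z.
Proof.
rewrite /dform !normrM (ger0_norm (kern_ge0 _ _)) -mulrDl ler_wpM2r ?kern_ge0//.
set A := w _ - _; set B := phi _ - _.
rewrite -[A * A]expr2 -[B * B]expr2 -(real_normK (num_real A)) -(real_normK (num_real B)).
by have := normr_ge0 A; have := normr_ge0 B; set X := `|A|; set Y := `|B|; nra.
Qed.

Lemma integrable_dform s b b' w phi : energy_space s b w ->
  energy_space s b' phi -> mu2.-integrable setT (fun z => (dform s w phi z)%:E).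
Proof.
move=> ew ephi; apply: (le_integrable_fin _ (dform_le s w phi)).
  by apply: measurable_dform; [exact: (energy_measurable ew)|exact: (energy_measurable ephi)].
have := integrableD measurableT (energy_integrable ew) (energy_integrable ephi).
by [].
Qed.

Lemma gagliardo_lty s w (g : R * R -> R) : continuous w ->
  (forall z, dform s w w z <= g z) -> mu2.-integrable setT (fun z => (g z)%:E) ->
  (gagliardo s w < +oo)%E.
Proof.
move=> cw wg ig; rewrite gagliardoE.
have : mu2.-integrable setT (fun z => (dform s w w z)%:E).
  apply: (le_integrable_fin _ _ ig); last by move=> z; rewrite ger0_norm ?dform_ge0.
  by apply: measurable_dform; exact: continuous_measurable.
by move/(integrable_fin_num measurableT); rewrite fin_numElt => /andP[].
Qed.

Lemma energy_sub s b b' c w phi : energy_space s b w -> energy_space s b' phi ->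
  energy_space s (Num.max b b') (fun x => w x - c * phi x).
Proof.
move=> ew ephi; have [cw w0 gw] := ew; have [cp p0 gp] := ephi.
have cwp : continuous (fun x => w x - c * phi x).
  by move=> x; apply: cvgB; [exact: cw|apply: cvgMr; exact: cp].
split=> //.
  by move=> x; rewrite ge_max => /andP[bx b'x]; rewrite w0// p0// mulr0 subr0.
apply: (@gagliardo_lty s _ (fun z => 2 * dform s w w z + (2 * c ^+ 2) * dform s phi phi z)) => //.
  move=> z; rewrite /dform !mulrA -mulrDl ler_wpM2r ?kern_ge0//.
  set A := w z.1; set B := w _; set C := phi z.1; set D := phi _.
  have := sqr_ge0 ((A - B) + c * (C - D)); nra.
have := integrableD measurableT (integrableZl measurableT 2 (energy_integrable ew))
  (integrableZl measurableT (2 * c ^+ 2) (energy_integrable ephi)).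
by [].
Qed.

Definition neg_part w x : R := Num.max (- w x) 0.

Lemma neg_part_ge0 w x : 0 <= neg_part w x.
Proof. by rewrite /neg_part le_max lexx orbT. Qed.

Lemma neg_part_lip (a b : R) :
  (Num.max (- a) 0 - Num.max (- b) 0) ^+ 2 <= (a - b) ^+ 2.
Proof.
have sa := sqr_ge0 a; have sb := sqr_ge0 b; have sab := sqr_ge0 (a - b).
case: (lerP 0 (-a)) => ha; case: (lerP 0 (-b)) => hb.
- by rewrite -sqrrN opprD !opprK addrC lexx.
- have h : 0 <= (- a) * b by rewrite mulr_ge0//; lra.
  lra.
- have h : 0 <= a * (- b) by rewrite mulr_ge0//; lra.
  lra.
- by rewrite subrr expr0n.
Qed.

Lemma continuous_max0 w : continuous w -> continuous (fun x => Num.max (w x) 0).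
Proof.
move=> cw; under eq_fun do rewrite maxr_absE subr0 addr0.
move=> x; apply: cvgMl; apply: cvgD; first exact: cw.
by apply: (@continuous_comp _ _ _ w Num.norm); [exact: cw|exact: norm_continuous].
Qed.

Lemma energy_neg_part s b w : energy_space s b w ->
  (forall x, 1 <= `|x| -> 0 <= w x) -> energy_space s 1 (neg_part w).
Proof.
move=> ew wpos; have [cw w0 gw] := ew.
have cn : continuous (neg_part w).
  apply: continuous_max0 => x; exact: (cvgN (cw x)).
split=> //.
  by move=> x /wpos wx; rewrite /neg_part; case: lerP => // h; lra.
apply: (@gagliardo_lty s _ (dform s w w)) => //; last exact: (energy_integrable ew).
by move=> z; rewrite /dform -!expr2 ler_wpM2r ?kern_ge0// neg_part_lip.
Qed.

Lemma kern_dilation s l z : kern s (l * z.1, l * z.2) = `|l| `^ (- (1 + 2 * s)) * kern s z.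
Proof. by rewrite /kern/= -mulrBr normrM powRM. Qed.

Lemma dform_dilation s l w phi z :
  dform s (fun x => w (l * x)) (fun x => phi (l * x)) z =
  `|l| `^ (1 + 2 * s) * dform s w phi (l * z.1, l * z.2).
Proof.
rewrite /dform/= kern_dilation.
have [->|l0] := eqVneq l 0; first by rewrite !mul0r subrr !mul0r mulr0.
have e : `|l| `^ (1 + 2 * s) * `|l| `^ (- (1 + 2 * s)) = 1.
  by rewrite -powRD ?subrr ?powRr0// normr_eq0 l0 implybT.
by rewrite mulrCA; congr (_ * _); rewrite mulrA e mul1r.
Qed.

(** The exponent is [1 + 2 * s] from the kernel and [- 2] from the change of
    variables in the plane. *)
Lemma form_dilation s l w phi : l != 0 -> measurable_fun setT w ->
  measurable_fun setT phi ->
  mu2.-integrable setT (fun z => (dform s w phi z)%:E) ->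
  mu2.-integrable setT (fun z => (dform s (fun x => w (l * x)) (fun x => phi (l * x)) z)%:E) /\
  form s (fun x => w (l * x)) (fun x => phi (l * x)) =
   `|l| `^ (2 * s - 1) * form s w phi.
Proof.
move=> l0 mw mphi iw.
have nl0 : `|l| != 0 by rewrite normr_eq0.
have dE : (fun z => (dform s (fun x => w (l * x)) (fun x => phi (l * x)) z)%:E) =
  (fun z => ((`|l| `^ (1 + 2 * s))%:E * (dform s w phi (l * z.1, l * z.2)%R)%:E)%E).
  by apply/funext => z; rewrite dform_dilation EFinM.
have md : measurable_fun setT (fun z => (dform s w phi z)%:E).
  exact: (measurable_int _ iw).
have id : mu2.-integrable setT (fun z : R * R => (dform s w phi (l * z.1, l * z.2)%R)%:E).
  apply/integrableP; split.
    apply: (measurableT_comp md).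
    by apply/measurable_fun_pairP; split; apply: measurable_funM => //.
  rewrite (@integral2_dilation _ l (fun z => `|(dform s w phi z)%:E|)%E)//; last exact: measurableT_comp.
  have /integrableP[_] := iw.
  move=> h; rewrite lte_mul_pinfty// lee_fin invr_ge0 exprn_ge0//.
split; first by rewrite dE; exact: integrableZl.
rewrite /form /Rintegral dE integralZl// (@integral2_dilation _ l (fun z => (dform s w phi z)%:E))//.
rewrite muleA -EFinM fineM//; last exact: integrable_fin_num.
congr (_ * _) => /=; rewrite -powR_mulrn// -powRN -powRD; last by rewrite nl0 implybT.
by congr (_ `^ _); ring.
Qed.

Lemma energy_dilation s b l w : l != 0 -> energy_space s b w ->
  energy_space s (b / `|l|) (fun x => w (l * x)).
Proof.
move=> l0 ew; have [cw w0 gw] := ew.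
have cwl : continuous (fun x => w (l * x)).
  by move=> x; apply: (@continuous_comp _ _ _ (fun x => l * x) w); [exact: mulrl_continuous|exact: cw].
split=> //.
  by move=> x; rewrite ler_pdivrMr ?normr_gt0// => h; apply: w0; rewrite normrM mulrC.
have mw := energy_measurable ew.
have [i _] := form_dilation l0 mw mw (energy_integrable ew).
by apply: (gagliardo_lty _ _ i).
Qed.

Lemma form_subl s b b' b'' c w phi psi : energy_space s b w ->
  energy_space s b' phi -> energy_space s b'' psi ->
  form s (fun x => w x - c * phi x) psi = form s w psi - c * form s phi psi.
Proof.
move=> ew ep epsi; rewrite /form.
have i1 := integrable_dform ew epsi; have i2 := integrable_dform ep epsi.
rewrite -RintegralZl// -RintegralB//; last exact: (integrableZl measurableT c i2).
by apply: eq_Rintegral => z _; rewrite /dform; ring.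
Qed.

Lemma energy_bounded s b w : energy_space s b w -> exists M, forall x, `|w x| <= M.
Proof.
case=> cw w0 _.
have [b0|b0] := ltP b 0.
  by exists 0 => x; rewrite w0 ?normr0// (le_trans (ltW b0)).
have bb : - b <= b by lra.
have cn : {within `[- b, b], continuous (fun x => `|w x|)}.
  apply: continuous_subspaceT => x; apply: (@continuous_comp _ _ _ w Num.norm); first exact: cw.
  exact: norm_continuous.
have [c _ hc] := EVT_max bb cn.
exists `|w c| => x; have [xb|bx] := lerP `|x| b; last by rewrite w0 ?normr0// ltW.
by apply: hc; rewrite in_itv/= -ler_norml.
Qed.

Lemma integrable_compact_support b w : continuous w -> (forall x, b <= `|x| -> w x = 0) ->
  mu.-integrable setT (EFin \o w).
Proof.
move=> cw w0.
have -> : EFin \o w = (EFin \o w) \_ `[- b, b].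
  apply/funext => x; rewrite /patch; case: ifPn => //; rewrite notin_setE/= in_itv/= -ler_norml.
  by move/negP; rewrite -ltNge => /ltW /w0 ->.
have [+ _] := @integrable_mkcond _ _ _ mu `[- b, b] (EFin \o w) (measurable_itv _).
apply.
apply: continuous_compact_integrable; first exact: segment_compact.
by apply: continuous_subspaceT.
Qed.

Lemma energy_Hs s b w : energy_space s b w -> Hs s w.
Proof.
case=> cw w0 gw; split=> //.
have mw := continuous_measurable cw.
rewrite inE; apply/andP; split; rewrite inE//=.
rewrite /finite_norm unlock poweR_lty//=.
have : mu.-integrable setT (EFin \o (fun x => w x ^+ 2)).
  apply: (@integrable_compact_support b).
    by move=> x; apply: (@continuous_comp _ _ _ w (fun y => y ^+ 2)); [exact: cw|exact: exprn_continuous].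
  by move=> x /w0 ->; rewrite expr0n.
move=> /integrableP[_]; apply: le_lt_trans; rewrite le_eqVlt; apply/orP; left; apply/eqP.
apply: eq_integral => x _ /=; rewrite powR_mulrn ?normr_ge0//.
by rewrite normrX.
Qed.

End energy_form.

(** * Weak solutions and the maximum principle *)

Section weak_solutions.
Context {R : realType}.
Local Notation mu := (@lebesgue_measure R).
Local Notation mu2 := (mu \x mu)%E.
Implicit Types (s b c : R) (w phi psi u g G : R -> R) (z : R * R).

Lemma continuous_ae_eq0 (U : set R) w : open U -> continuous w ->
  {ae mu, forall x, U x -> w x = 0} -> forall x, U x -> w x = 0.
Proof.
move=> oU cw [N [mN N0 UN]] x Ux; apply: contrapT => /eqP wx0.
have oV : open (U `&` w @^-1` [set~ 0]).
  apply: openI => //; apply: open_comp; first by move=> y _; exact: cw.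
  by rewrite openC; exact: closed_eq.
have [/= e e0 eV] : nbhs x (U `&` w @^-1` [set~ 0]).
  by apply: open_nbhs_nbhs; split => //; split => //=; apply/eqP.
have : (mu (ball x e) <= mu N)%E.
  apply: le_measure; rewrite ?inE//; first exact: measurable_ball.
  move=> y xy; apply: UN => /= h.
  by have [Uy] := eV _ xy; apply; exact: h.
rewrite N0 lebesgue_measure_ball ?(ltW e0)// lee_fin.
by rewrite leNgt mulrn_wgt0.
Qed.

Lemma continuous_integral_eq0 w : continuous w -> (forall x, 0 <= w x) ->
  (\int[mu]_x (w x)%:E = 0)%E -> forall x, w x = 0.
Proof.
move=> cw w0 iw x; apply: (@continuous_ae_eq0 setT w) => //; first exact: openT.
have mw : measurable_fun setT (EFin \o w).
  by apply/measurable_EFinP; exact: continuous_measurable.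
have := @ae_eq_integral_abs _ _ _ mu setT measurableT (EFin \o w) mw.
move=> [+ _]; have -> : (\int[mu]_x `|(EFin \o w) x| = 0)%E.
  by rewrite -iw; apply: eq_integral => y _ /=; rewrite ger0_norm.
move=> /(_ erefl); apply: filterS => y /= /(_ I) + _.
by move=> [].
Qed.

(** Bridges the gap between the complement of a closed support and the closed
    condition on [`|x|] in [energy_space]. *)
Lemma continuous_vanish_closed b w : continuous w ->
  (forall x, b < `|x| -> w x = 0) -> forall x, b <= `|x| -> w x = 0.
Proof.
move=> cw w0 x; rewrite le_eqVlt => /predU1P[bx|]; last exact: w0.
apply: contrapT => /eqP wx0.
have oV : open (w @^-1` [set~ 0]).
  apply: open_comp; first by move=> y _; exact: cw.
  by rewrite openC; exact: closed_eq.
have [/= e e0 he] : nbhs x (w @^-1` [set~ 0]).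
  by apply: open_nbhs_nbhs; split => //=; apply/eqP.
have h (y : R) : `|x - y| < e -> b < `|y| -> False.
  by move=> xy by_; have := he y xy; apply; exact: w0.
have [x0|x0] := leP 0 x.
- apply: (h (x + e / 2)).
    by rewrite opprD addrA subrr add0r normrN gtr0_norm; lra.
  by rewrite bx !ger0_norm; lra.
- apply: (h (x - e / 2)).
    by rewrite opprB addrCA subrr addr0 gtr0_norm; lra.
  by rewrite bx !ltr0_norm; lra.
Qed.

Lemma supp_vanish w : continuous w -> supp w `<=` `[-1, 1] ->
  forall x, 1 <= `|x| -> w x = 0.
Proof.
move=> cw sw; apply: continuous_vanish_closed => // x x1.
have : ~ supp w x.
  by move/sw; rewrite /= in_itv/= -ler_norml leNgt x1.
move=> /contrapT[U [oU wU] Ux].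
exact: (continuous_ae_eq0 oU cw wU).
Qed.

Lemma vanish_supp w : (forall x, 1 <= `|x| -> w x = 0) -> supp w `<=` `[-1, 1].
Proof.
move=> w0 x; apply: contraPP => xn; apply.
exists (~` `[-1, 1]) => //; split; first by rewrite openC; exact: itv_closed.
apply/aeW => y /= yn; apply: w0; rewrite leNgt; apply/negP => y1; apply: yn.
by rewrite in_itv/= -ler_norml ltW.
Qed.

(** The weak formulation for data [G] in real numbers, with continuous test
    functions. *)
Definition solves s G u := energy_space s 1 u /\
  forall phi, energy_space s 1 phi ->
    gamma_const s / 2 * form s u phi = \int[mu]_x (G x * phi x).

Lemma weak_solution_solves s g G u : weak_solution s g u -> continuous u ->
  {in `]-1, 1[, g =1 G} -> solves s G u.
Proof.
move=> [[_ gu] su wu] cu gG.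
have eu : energy_space s 1 u by split => //; exact: supp_vanish.
split=> // phi ephi; have [cp p0 gp] := ephi.
have := wu phi (energy_Hs ephi) (vanish_supp p0).
rewrite /fraclap_form.
have -> : (\int[mu2]_z ((u z.1 - u z.2) * (phi z.1 - phi z.2)
       / `|z.1 - z.2| `^ (1 + 2 * s))%:E = (form s u phi)%:E)%E.
  rewrite fineK; last exact: (integrable_fin_num _ (integrable_dform eu ephi)).
  by apply: eq_integral => z _; rewrite /dform /kern powRN.
rewrite -EFinM => /(congr1 fine) /= ->.
rewrite -/(Rintegral _ _ _) Rintegral_mkcond.
apply: eq_Rintegral => x _; rewrite patchE.
case: ifPn => [/set_mem/= x1|]; first by rewrite gG.
rewrite notin_setE/= in_itv/= -ltr_norml => /negP; rewrite -leNgt => /p0 ->.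
by rewrite mulr0.
Qed.

Lemma Rintegral_dilation (l : R) w : l != 0 -> measurable_fun setT w ->
  \int[mu]_x w (l * x) = `|l|^-1 * \int[mu]_x w x.
Proof.
move=> l0 mw; have l1 : 0 < `|l| by rewrite normr_gt0.
have mW : measurable_fun setT (fun x => (w x)%:E) by exact/measurable_EFinP.
rewrite /Rintegral [in RHS](integral_dilation l0)//.
set X := (\int[mu]_x _)%E; case: X => [x| |]/=.
- by rewrite mulrA mulVf ?mul1r// gt_eqF.
- by rewrite gt0_muley ?lte_fin//= mulr0.
- by rewrite gt0_muleNy ?lte_fin//= mulr0.
Qed.

Lemma energy_weaken s b b' w : b <= b' -> energy_space s b w -> energy_space s b' w.
Proof. by move=> bb [cw w0 gw]; split => // x /(le_trans bb)/w0. Qed.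

(** The dilated solution [x |-> u (l * x)] is again tested against functions
    supported in [-1, 1]: since [`|l| <= 1], rescaling such a function keeps its
    support in [-1, 1], and the equation of [u] applies to it. *)
Lemma solves_dilation s G u l phi : solves s G u -> continuous G ->
  l != 0 -> `|l| <= 1 -> energy_space s 1 phi ->
  gamma_const s / 2 * form s (fun x => u (l * x)) phi =
  `|l| `^ (2 * s) * \int[mu]_x (G (l * x) * phi x).
Proof.
move=> [eu hu] cG l0 l1 ephi.
have nl0 : 0 < `|l| by rewrite normr_gt0.
pose psi x := phi (l^-1 * x).
have epsi : energy_space s 1 psi.
  have := energy_dilation (invr_neq0 l0) ephi.
  by apply: energy_weaken; rewrite normfV div1r invrK.
have psiE : phi = fun x => psi (l * x).
  by apply/funext => x; rewrite /psi mulrA mulVf// mul1r.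
have [_] := form_dilation l0 (energy_measurable eu) (energy_measurable epsi) (integrable_dform eu epsi).
rewrite -psiE => ->.
have mGp : measurable_fun setT (fun x => G x * psi x).
  by apply: measurable_funM; [exact: continuous_measurable|exact: (energy_measurable epsi)].
have := Rintegral_dilation l0 mGp.
have -> : \int[mu]_x (G (l * x) * psi (l * x)) = \int[mu]_x (G (l * x) * phi x).
  by apply: eq_Rintegral => x _; rewrite psiE.
move=> ->; rewrite -(hu _ epsi).
have -> : `|l| `^ (2 * s - 1) = `|l| `^ (2 * s) * `|l|^-1.
  by rewrite -powR_inv1// -powRD// (gt_eqF nl0) implybT.
set g := gamma_const s; set F := form _ _ _; set a := _ `^ _.
by clearbody g F a; ring.
Qed.

(** A double integral controls a simple one as soon as its integrand dominates
    [w x] for [y] in a set of measure 1 outside (-1, 1).  This replaces a Poincare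
    inequality below: the pairs with one point in (-1, 1) and the other in [2, 3]
    already carry enough energy. *)
Lemma le_Rintegral_strip w (F : R * R -> R) : continuous w ->
  (forall x, 0 <= w x) -> (forall x, 1 <= `|x| -> w x = 0) ->
  mu2.-integrable setT (fun z => (F z)%:E) ->
  (forall z, w z.1 * \1_(`[2, 3]) z.2 <= F z) ->
  \int[mu]_x w x <= \int[mu2]_z F z.
Proof.
move=> cw w0 w1 iF wF.
have mw := continuous_measurable cw.
have mS : measurable_fun setT (fun z : R * R => w z.1 * \1_(`[2, 3]) z.2 : R).
  by apply: measurable_funM; [exact: measurable_proj1|apply: measurable_proj2; exact: measurable_indic].
have wE : (\int[mu]_x (w x)%:E = \int[mu2]_z (w z.1 * \1_(`[2, 3]) z.2)%:E)%E.
  rewrite tonelli1//; last 2 first.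
  - exact/measurable_EFinP.
  - by move=> z; rewrite lee_fin mulr_ge0.
  apply: eq_integral => x _ /=.
  under eq_integral do rewrite EFinM.
  rewrite integralZl//; last first.
    exact: integrable_indic_itv.
  have e : mu (`[2, 3]%classic : set R) = 1%E.
    by rewrite lebesgue_measure_itv/= lte_fin ltr_nat/= -EFinB; congr EFin; lra.
  by rewrite integral_indic//= setIT e mule1.
have iw := integrable_compact_support cw w1.
rewrite /Rintegral fine_le//.
- exact: (integrable_fin_num measurableT iw).
- exact: (integrable_fin_num measurableT iF).
rewrite wE; apply: ge0_le_integral => //.
- by move=> z _; rewrite lee_fin mulr_ge0.
- exact/measurable_EFinP.
- exact: (measurable_int _ iF).
- by move=> z _; rewrite lee_fin.
Qed.

Lemma Rintegral_continuous_le0 b w : continuous w -> (forall x, 0 <= w x) ->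
  (forall x, b <= `|x| -> w x = 0) -> \int[mu]_x w x <= 0 -> forall x, w x = 0.
Proof.
move=> cw w0 w1 iw; apply: continuous_integral_eq0 => //.
have := integrable_fin_num measurableT (integrable_compact_support cw w1).
move=> /fineK <-; congr EFin; apply/eqP; rewrite eq_le iw/=.
by apply: fine_ge0; apply: integral_ge0 => x _; rewrite lee_fin.
Qed.

Lemma strip_dist (x y : R) : `|x| < 1 -> 2 <= y <= 3 -> 0 < `|x - y| <= 4.
Proof.
rewrite ltr_norml => /andP[x1 x2] /andP[y1 y2].
by rewrite ltr0_norm; lra.
Qed.

Lemma kern_strip s x y : 0 < s -> `|x| < 1 -> 2 <= y <= 3 ->
  1 <= 4 `^ (1 + 2 * s) * kern s (x, y).
Proof.
move=> s0 x1 /(strip_dist x1)/andP[d0 d4].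
rewrite /kern/= powRN ler_pdivlMr ?powR_gt0// mul1r.
by apply: ge0_ler_powR; rewrite ?nnegrE//; lra.
Qed.

(** Testing with the negative part [n] of [w] gives
    [form s w n <= - form s n n], so [form s n n <= 0]; the part of [form s n n]
    with [y] in [2, 3], where [n y = 0], bounds the integral of [n ^+ 2]. *)
Lemma weak_maximum_principle s b w : 0 < s -> energy_space s b w ->
  (forall x, 1 <= `|x| -> 0 <= w x) -> 0 <= form s w (neg_part w) ->
  forall x, 0 <= w x.
Proof.
move=> s0 ew wpos fw.
have en := energy_neg_part ew wpos; have [cn n0 _] := en.
pose C : R := 4 `^ (1 + 2 * s).
have C0 : 0 <= C by exact: powR_ge0.
suff n_0 x : neg_part w x = 0.
  move=> x; have := n_0 x; rewrite /neg_part.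
  have : - w x <= Num.max (- w x) 0 by rewrite le_max lexx.
  by move=> /[swap] ->; rewrite oppr_le0.
apply/eqP; rewrite -sqrf_eq0; apply/eqP; move: x.
apply: (@Rintegral_continuous_le0 1).
- by move=> x; apply: (@continuous_comp _ _ _ (neg_part w) (fun y => y ^+ 2)); [exact: cn|exact: exprn_continuous].
- by move=> x; exact: sqr_ge0.
- by move=> x /n0 ->; rewrite expr0n.
have i1 := integrable_dform ew en.
apply: (@le_trans _ _ (\int[mu2]_z (- C * dform s w (neg_part w) z))); last first.
  rewrite RintegralZl// mulNr oppr_le0 mulr_ge0//.
apply: le_Rintegral_strip.
- by move=> x; apply: (@continuous_comp _ _ _ (neg_part w) (fun y => y ^+ 2)); [exact: cn|exact: exprn_continuous].
- by move=> x; exact: sqr_ge0.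
- by move=> x /n0 ->; rewrite expr0n.
- exact: (integrableZl measurableT (- C) i1).
move=> [x y]/=.
(* with [n] the negative part, [(w x - w y + n x - n y) * (n x - n y) <= 0] *)
have h : dform s w (neg_part w) (x, y) <= - ((neg_part w x - neg_part w y) ^+ 2 * kern s (x, y)).
  rewrite -mulNr /dform/= ler_wpM2r ?kern_ge0// /neg_part.
  by case: (lerP 0 (- w x)) => ha; case: (lerP 0 (- w y)) => hb; nra.
apply: (@le_trans _ _ (C * ((neg_part w x - neg_part w y) ^+ 2 * kern s (x, y)))); last by nra.
have q0 : 0 <= C * ((neg_part w x - neg_part w y) ^+ 2 * kern s (x, y)).
  by apply: mulr_ge0 => //; apply: mulr_ge0; [exact: sqr_ge0|exact: kern_ge0].
rewrite indicE; case: (boolP (y \in _)) => [|_]; last by rewrite mulr0.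
rewrite inE/= in_itv/= mulr1 => y23.
have [x1|x1] := ltP `|x| 1; last by rewrite {1}n0// expr0n.
rewrite (n0 y) ?subr0; last by rewrite ger0_norm; lra.
have := kern_strip s0 x1 y23; rewrite -/C.
by have := sqr_ge0 (neg_part w x); nra.
Qed.

End weak_solutions.

(** * Substitution, and the radial profile of the torsion function *)

Section substitution.
Context {R : realType}.
Local Notation mu := (@lebesgue_measure R).
Implicit Types (F dF G : R -> R) (a b x r s : R).

Lemma is_derive_continuous F x d : is_derive x 1 F d -> {for x, continuous F}.
Proof. by case=> dF _; apply/differentiable_continuous/derivable1_diffP. Qed.

Lemma is_derive1E F x d : is_derive x 1 F d -> F^`()%classic x = d.
Proof. by case=> _ <-; rewrite derive1E. Qed.

Lemma derive_LRcontinuous F dF a b : a < b ->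
  (forall x, a <= x <= b -> is_derive x 1 F (dF x)) ->
  derivable_oo_LRcontinuous F a b.
Proof.
move=> ab dFF; split.
- by move=> x; rewrite in_itv/= => /andP[/ltW ax /ltW xb]; have [] := dFF x; rewrite ?ax.
- apply: cvg_at_right_filter; apply: (@is_derive_continuous _ _ (dF a)).
  by apply: dFF; rewrite lexx ltW.
- apply: cvg_at_left_filter; apply: (@is_derive_continuous _ _ (dF b)).
  by apply: dFF; rewrite lexx ltW.
Qed.

Lemma derive1_cvg F dF a b : a < b ->
  (forall x, a <= x <= b -> is_derive x 1 F (dF x)) ->
  (forall x, a <= x <= b -> {for x, continuous dF}) ->
  [/\ {in `]a, b[, continuous F^`()%classic}, F^`()%classic x @[x --> a^'+] --> dF a &
      F^`()%classic x @[x --> b^'-] --> dF b].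
Proof.
move=> ab dFF cdF; split.
- move=> x; rewrite in_itv/= => /andP[ax xb].
  have ex : F^`()%classic x = dF x by apply: is_derive1E; apply: dFF; rewrite !ltW.
  rewrite /continuous_at ex.
  apply: cvg_trans (cdF x _); last by rewrite !ltW.
  apply: near_eq_cvg; near=> y.
  apply/esym/is_derive1E/dFF.
  by apply/andP; split; apply: ltW; near: y; [exact: lt_nbhsr|exact: lt_nbhsl].
- have := cdF a; rewrite lexx ltW// => /(_ erefl) ca.
  apply: cvg_trans (cvg_at_right_filter ca).
  apply: near_eq_cvg; near=> y.
  apply/esym/is_derive1E/dFF.
  by apply/andP; split; apply: ltW; near: y; [exact: nbhs_right_gt|exact: nbhs_right_lt].
- have := cdF b; rewrite lexx ltW// => /(_ erefl) ca.
  apply: cvg_trans (cvg_at_left_filter ca).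
  apply: near_eq_cvg; near=> y.
  apply/esym/is_derive1E/dFF.
  by apply/andP; split; apply: ltW; near: y; [exact: nbhs_left_gt|exact: nbhs_left_lt].
Unshelve. all: by end_near. Qed.

Lemma substitution_decreasing F dF G a b : a < b ->
  (forall x, a <= x <= b -> is_derive x 1 F (dF x)) ->
  (forall x, a <= x <= b -> {for x, continuous dF}) ->
  {in `[a, b] &, {homo F : x y /~ (x < y)%R}} ->
  {within `[F b, F a], continuous G} ->
  (\int[mu]_(x in `[F b, F a]) (G x)%:E =
   \int[mu]_(x in `[a, b]) (G (F x) * - dF x)%:E)%E.
Proof.
move=> ab dFF cdF hF cG.
have [h1 h2 h3] := derive1_cvg ab dFF cdF.
have h2' : cvg (F^`()%classic x @[x --> a^'+]) by apply/cvg_ex; exists (dF a).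
have h3' : cvg (F^`()%classic x @[x --> b^'-]) by apply/cvg_ex; exists (dF b).
have hLR := derive_LRcontinuous ab dFF.
have := integration_by_substitution_decreasing (ltW ab) hF h1 h2' h3' hLR cG.
move=> ->; apply: eq_integral => x; rewrite inE/= in_itv/= => xab.
by rewrite !fctE/= (is_derive1E (dFF _ xab)).
Qed.

Lemma substitution_increasing F dF G a b : a < b ->
  (forall x, a <= x <= b -> is_derive x 1 F (dF x)) ->
  (forall x, a <= x <= b -> {for x, continuous dF}) ->
  {in `[a, b] &, {homo F : x y / (x < y)%R}} ->
  {within `[F a, F b], continuous G} ->
  (\int[mu]_(x in `[F a, F b]) (G x)%:E =
   \int[mu]_(x in `[a, b]) (G (F x) * dF x)%:E)%E.
Proof.
move=> ab dFF cdF hF cG.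
have [h1 h2 h3] := derive1_cvg ab dFF cdF.
have h2' : cvg (F^`()%classic x @[x --> a^'+]) by apply/cvg_ex; exists (dF a).
have h3' : cvg (F^`()%classic x @[x --> b^'-]) by apply/cvg_ex; exists (dF b).
have hLR := derive_LRcontinuous ab dFF.
have := integration_by_substitution_increasing (ltW ab) hF h1 h2' h3' hLR cG.
move=> ->; apply: eq_integral => x; rewrite inE/= in_itv/= => xab.
by rewrite !fctE/= (is_derive1E (dFF _ xab)).
Qed.

Lemma is_derive_integral F x : continuous F -> 0 < x ->
  is_derive x 1 (fun x => \int[mu]_(t in `[0, x]) F t) (F x).
Proof.
move=> cf x0; have xx : x < x + 1 by lra.
have i : mu.-integrable `[0, x + 1] (EFin \o F).
  by apply: continuous_compact_integrable; [exact: segment_compact|exact: continuous_subspaceT].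
have [i1 i2] := continuous_FTC1_closed xx i x0 (cf x).
by split; [exact: i1|rewrite -derive1E i2].
Qed.

Lemma continuous_powR_gt0 r x : 0 < x -> {for x, continuous (fun y => y `^ r)}.
Proof. by move=> x0; exact: (is_derive_continuous (is_derive1_powR r x0)). Qed.

(** The positive part of [x] to the power [s]: unlike [x `^ s] alone, whose value
    for negative [x] is a convention, it is continuous on the whole line. *)
Definition pos_powR s x := Num.max x 0 `^ s.

Lemma pos_powRE s x : 0 <= x -> pos_powR s x = x `^ s.
Proof. by move=> x0; rewrite /pos_powR max_l. Qed.

Lemma pos_powR_ge0 s x : 0 <= pos_powR s x. Proof. exact: powR_ge0. Qed.

Lemma pos_powR_le0 s x : s != 0 -> x <= 0 -> pos_powR s x = 0.
Proof. by move=> s0 x0; rewrite /pos_powR max_r// powR0. Qed.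

Lemma continuous_pos_powR s : 0 < s -> continuous (pos_powR s).
Proof.
move=> s0 x; have [x0|x0|<-] := ltgtP 0 x.
- rewrite /continuous_at pos_powRE ?ltW//.
  apply: cvg_trans (@continuous_powR_gt0 s x x0).
  apply: near_eq_cvg; near=> y; rewrite pos_powRE// ltW//.
  by near: y; exact: lt_nbhsr.
- rewrite /continuous_at (pos_powR_le0 (lt0r_neq0 s0)) ?ltW//.
  apply: cvg_near_cst; near=> y; rewrite pos_powR_le0 ?lt0r_neq0// ltW//.
  by near: y; exact: lt_nbhsl.
- rewrite /continuous_at (pos_powR_le0 (lt0r_neq0 s0))//.
  apply/cvgr0Pnorm_lt => e e0.
  have d0 : 0 < e `^ s^-1 by exact: powR_gt0.
  near=> y; rewrite ger0_norm ?pos_powR_ge0//.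
  have [y0|y0] := leP y 0; first by rewrite pos_powR_le0 ?lt0r_neq0.
  rewrite pos_powRE ?ltW//.
  have -> : e = (e `^ s^-1) `^ s by rewrite -powRrM mulVf ?lt0r_neq0// powRr1// ltW.
  apply: gt0_ltr_powR => //; rewrite ?nnegrE ?ltW//.
  by near: y; exact: lt_nbhsl.
Unshelve. all: by end_near. Qed.

End substitution.

Section profile.
Context {R : realType}.
Local Notation mu := (@lebesgue_measure R).
Variable s : R.
Hypothesis s01 : 0 < s < 1.
Implicit Types (m n : R).
Let s0 : 0 < s. Proof. by case/andP: s01. Qed.
Let s1 : s < 1. Proof. by case/andP: s01. Qed.

(** The density [t ^ s / (1 + t)], truncated so as to be continuous on the line. *)
Definition pden n : R := pos_powR s n / (1 + Num.max n 0).

Definition pint n : R := \int[mu]_(t in `[0, n]) pden t.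

(** As [t ^ s / (1 + t) = t ^ (s - 1) - t ^ (s - 1) / (1 + t)], this is the integral
    of [t ^ (s - 1) / (1 + t)] over (0, n): it increases with [n] to the finite
    limit [kappa].  The singularity at 0 of that integrand is avoided by this form. *)
Definition pfun n : R := n `^ s / s - pint n.

Lemma pden_continuous : continuous pden.
Proof.
move=> x; apply: cvgM; first exact: continuous_pos_powR.
apply: cvgV; last first.
  apply: cvgD; first exact: cvg_cst.
  by apply: (@continuous_max0 _ id) => y; exact: cvg_id.
by rewrite gt_eqF// ltr_wpDr// le_max lexx orbT.
Qed.

Lemma pden_ge0 n : 0 <= pden n.
Proof. by rewrite divr_ge0 ?pos_powR_ge0// addr_ge0// le_max lexx orbT. Qed.

Lemma pden_integrable n : mu.-integrable `[0, n] (EFin \o pden).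
Proof.
apply: continuous_compact_integrable; first exact: segment_compact.
exact/continuous_subspaceT/pden_continuous.
Qed.

Lemma pint_EFin n : (\int[mu]_(t in `[0%R, n]) (pden t)%:E = (pint n)%:E)%E.
Proof. by rewrite fineK//; exact: (integrable_fin_num _ (pden_integrable n)). Qed.

Lemma pint_derive n : 0 < n -> is_derive n 1 pint (pden n).
Proof. exact: (is_derive_integral pden_continuous). Qed.

Lemma pfun_derive n : 0 < n -> is_derive n 1 pfun (n `^ (s - 1) / (1 + n)).
Proof.
move=> n0.
have h1 := is_derive1_powR s n0; have h2 := pint_derive n0.
have -> : pfun = (s^-1 \*: (fun x => x `^ s)) - pint.
  by apply/funext => x; rewrite /pfun !fctE/= mulrC.
apply: is_derive_eq.
rewrite /pden pos_powRE ?ltW// max_l ?ltW//.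
have -> : n `^ s = n * n `^ (s - 1) by rewrite mulr_powRB1 ?ltW.
rewrite /GRing.scale/=; field.
by rewrite !gt_eqF//; lra.
Qed.

Lemma pfun_continuous n : {within `[0, n], continuous pfun}.
Proof.
have [n0|n0] := leP n 0.
  have [->|nn] := eqVneq n 0; first by rewrite set_itv1; exact: continuous_subspace1.
  rewrite set_itv_ge; first exact: continuous_subspace0.
  by rewrite bnd_simp -ltNge lt_neqAle nn.
have h := parameterized_integral_continuous (ltW n0) (pden_integrable n).
move=> x; apply: cvgB; last exact: h.
apply: cvgMl; move: x.
have : {within `[0, n], continuous (pos_powR s)}.
  by apply: continuous_subspaceT; exact: continuous_pos_powR.
apply: subspace_eq_continuous => x; rewrite inE/= in_itv/= => /andP[x0 _].
by rewrite /from_subspace/= pos_powRE.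
Qed.

Lemma pfun_nd m n : 0 <= m -> m <= n -> pfun m <= pfun n.
Proof.
move=> m0 mn.
apply: (ger0_derive1_le_cc (a := 0) (b := n)) => //.
- move=> x; rewrite in_itv/= => /andP[x0 _].
  by have [] := pfun_derive x0.
- move=> x; rewrite in_itv/= => /andP[x0 _].
  rewrite (is_derive1E (pfun_derive x0)) divr_ge0 ?powR_ge0//; lra.
- exact: pfun_continuous.
- by rewrite in_itv/= m0.
- by rewrite in_itv/= lexx (le_trans m0).
Qed.

(** For [t >= 1] the integrand [t ^ (s - 1) / (1 + t)] is below [t ^ (s - 2)], whose
    integral over (1, +oo) is [(1 - s)^-1]. *)
Lemma pfun_le n : 0 <= n -> pfun n <= pfun 1 + (1 - s)^-1.
Proof.
move=> n0; have [n1|n1] := leP n 1.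
  by rewrite (le_trans (pfun_nd n0 n1))// lerDl invr_ge0 subr_ge0 ltW.
pose q x : R := - (1 - s)^-1 * x `^ (s - 1) - pfun x.
have dq (x : R) : 0 < x -> is_derive x 1 q (x `^ (s - 2) / (1 + x)).
  move=> x0.
  have h1 := is_derive1_powR (s - 1) x0; have h2 := pfun_derive x0.
  have -> : q = ((- (1 - s)^-1) \*: (fun x => x `^ (s - 1))) - pfun by [].
  apply: is_derive_eq.
  have -> : s - 1 - 1 = s - 2 by lra.
  have -> : x `^ (s - 1) = x * x `^ (s - 2).
    rewrite -{2}(powRr1 (ltW x0)) -powRD; last by rewrite (gt_eqF x0) implybT.
    by congr (_ `^ _); lra.
  rewrite /GRing.scale/=; field.
  by apply/andP; split; rewrite gt_eqF// ?subr_gt0//; lra.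
have : q 1 <= q n.
  apply: (@ger0_derive1_le_cc R q 1 n).
  - move=> x; rewrite in_itv/= => /andP[x1 _].
    by have [] := dq x (lt_trans ltr01 x1).
  - move=> x; rewrite in_itv/= => /andP[x1 _].
    have x0 := lt_trans ltr01 x1.
    by rewrite (is_derive1E (dq _ x0)) divr_ge0 ?powR_ge0//; lra.
  - apply: derivable_within_continuous => x; rewrite in_itv/= => /andP[x1 _].
    by have [] := dq x (lt_le_trans ltr01 x1).
  - by rewrite in_itv/= lexx ltW.
  - by rewrite in_itv/= lexx ltW.
  - exact: ltW.
rewrite /q powR1.
have : 0 <= (1 - s)^-1 * n `^ (s - 1) by rewrite mulr_ge0 ?powR_ge0// invr_ge0 subr_ge0 ltW.
by rewrite !mulNr; lra.
Qed.

(** The integral of [t ^ (s - 1) / (1 + t)] over (0, +oo), that is [pi / sin (pi * s)]. *)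
Definition kappa : R := sup [set pfun n | n in [set n | 0 <= n]].

Lemma pfun_le_kappa n : 0 <= n -> pfun n <= kappa.
Proof.
move=> n0; apply: ub_le_sup; last by exists n.
exists (pfun 1 + (1 - s)^-1) => _ [m m0 <-]; exact: pfun_le.
Qed.

Lemma pfun0 : pfun 0 = 0.
Proof.
rewrite /pfun powR0 ?lt0r_neq0// mul0r sub0r /pint set_itv1.
by rewrite Rintegral_set1 oppr0.
Qed.

Lemma kappa_ge0 : 0 <= kappa.
Proof. by rewrite -pfun0; exact: pfun_le_kappa. Qed.

Lemma pfun_cvg_kappa e : 0 < e -> exists2 n, 0 <= n & kappa - e < pfun n.
Proof.
move=> e0.
have hs : has_sup [set pfun n | n in [set n | 0 <= n]].
  split; first by exists (pfun 0); exists 0 => //=.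
  exists (pfun 1 + (1 - s)^-1) => _ [m m0 <-]; exact: pfun_le.
by have [_ [n n0 <-] h] := sup_adherent e0 hs; exists n.
Qed.

Lemma pfun_ge0 n : 0 <= n -> 0 <= pfun n.
Proof. by move=> n0; rewrite -pfun0; exact: pfun_nd. Qed.

End profile.

(** * Integrals outside a pseudo-hyperbolic neighbourhood of the diagonal *)

Section pseudo_hyperbolic.
Context {R : realType}.
Local Notation mu := (@lebesgue_measure R).
Local Notation mu2 := (mu \x mu)%E.
Implicit Types (x y q Q s : R) (z : R * R).

(** The function [(1 - x ^+ 2) ^ s] on (-1, 1), extended by 0.  Its fractional
    Laplacian is constant on (-1, 1), see [form_torsion]. *)
Definition torsion s x : R := pos_powR s (1 - x ^+ 2).

(** For [x] in (-1, 1), the point on the right of [x] at pseudo-hyperbolic distance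
    [`|x - y| / (1 - x * y) = Q^-1] from [x].  The Moebius map [Q |-> ypt Q x] sends
    [1, +oo) onto (x, 1]. *)
Definition ypt Q x : R := (1 + Q * x) / (Q + x).

(** For points of (-1, 1), the pairs at pseudo-hyperbolic distance more than [Q^-1].  The
    principal value is taken along these sets, rather than along [`|x - y| > e], because
    the truncated integrals of the torsion function then have a closed form. *)
Definition far Q : set (R * R) := [set z | 1 - z.1 * z.2 < Q * `|z.1 - z.2|].

Lemma torsion_ge0 s x : 0 <= torsion s x. Proof. exact: pos_powR_ge0. Qed.

Lemma torsion_continuous s : 0 < s -> continuous (torsion s).
Proof.
move=> s0 x; apply: (@continuous_comp _ _ _ (fun x => 1 - x ^+ 2) (pos_powR s)).
  by apply: cvgB; [exact: cvg_cst|exact: exprn_continuous].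
exact: continuous_pos_powR.
Qed.

Lemma torsion_eq0 s x : 0 < s -> 1 <= `|x| -> torsion s x = 0.
Proof.
move=> s0 x1; rewrite /torsion pos_powR_le0 ?lt0r_neq0// subr_le0.
by rewrite -real_normK ?num_real// exprn_ege1.
Qed.

Lemma abs_lt1 x : `|x| < 1 -> 0 < 1 - x ^+ 2.
Proof. by move=> x1; rewrite subr_gt0 -real_normK ?num_real// exprn_ilt1. Qed.

Lemma torsionE s x : `|x| < 1 -> torsion s x = (1 - x ^+ 2) `^ s.
Proof. by move=> /abs_lt1 x1; rewrite /torsion pos_powRE// ltW. Qed.

Lemma torsion_le1 s x : 0 < s -> torsion s x <= 1.
Proof.
move=> s0; have [x1|x1] := ltP `|x| 1; last by rewrite torsion_eq0.
rewrite torsionE//; have a0 := abs_lt1 x1.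
have e1 : 1 `^ s = 1 :> R by rewrite powR1.
rewrite -[leRHS]e1; apply: ge0_ler_powR; rewrite ?nnegrE ?(ltW a0) ?(ltW s0)//.
by rewrite lerBlDr lerDl sqr_ge0.
Qed.

Lemma torsionN s x : torsion s (- x) = torsion s x.
Proof. by rewrite /torsion sqrrN. Qed.

Lemma powRD_gt0 (c t t' : R) : 0 < c -> c `^ (t + t') = c `^ t * c `^ t'.
Proof. by move=> c0; rewrite powRD// (gt_eqF c0) implybT. Qed.

Lemma powR_shift_cvg0 r x : 0 < r -> (y - x) `^ (- r) @[y --> +oo] --> 0.
Proof.
move=> r0; apply/cvgr0Pnorm_lt => e e0.
near=> y.
have h : e^-1 `^ r^-1 < y - x by rewrite ltrBrDr; near: y; apply: nbhs_pinfty_gt; exact: num_real.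
have yx : 0 < y - x by apply: le_lt_trans h; exact: powR_ge0.
rewrite ger0_norm ?powR_ge0// powRN invf_plt ?posrE ?powR_gt0//.
have -> : e^-1 = (e^-1 `^ r^-1) `^ r.
  by rewrite -powRrM mulVf ?lt0r_neq0// powRr1// invr_ge0 ltW.
by apply: gt0_ltr_powR => //; rewrite nnegrE ?powR_ge0// ltW.
Unshelve. all: by end_near. Qed.

Section fixed_point.
Variables (s x Q : R).
Hypotheses (s0 : 0 < s) (x1 : `|x| < 1) (Q1 : 1 < Q).
Let a : R := 1 - x ^+ 2.

Let a0 : 0 < a. Proof. exact: abs_lt1. Qed.

Let d0 q : 1 <= q -> 0 < q + x.
Proof. by move: x1; rewrite ltr_norml => /andP[h1 h2]; lra. Qed.

Lemma ypt_sub q : 1 <= q -> ypt q x - x = a / (q + x).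
Proof. by move=> /d0 d; rewrite /ypt /a; field; rewrite gt_eqF. Qed.

Lemma ypt_gt q : 1 <= q -> x < ypt q x.
Proof. by move=> q1; rewrite -subr_gt0 ypt_sub// divr_gt0// d0. Qed.

Lemma ypt_sqr q : 1 <= q -> 1 - ypt q x ^+ 2 = (q ^+ 2 - 1) * a * ((q + x) ^- 2).
Proof. by move=> /d0 d; rewrite /ypt /a; field; rewrite gt_eqF. Qed.

Lemma ypt_derive q : 1 <= q -> is_derive q 1 (fun q => ypt q x) (- a * ((q + x) ^- 2)).
Proof.
move=> q1; have dd := d0 q1.
have nz : q + x != 0 by rewrite gt_eqF.
have h : is_derive q 1 (fun q : R => (q + x)^-1) (- (q + x) ^- 2 *: 1).
  apply: (@is_deriveV R (fun q : R => q + x) q 1 1) => //.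
  by apply: is_derive_eq; rewrite addr0.
have -> : (fun q => ypt q x) = (fun q => 1 + q * x) \* (fun q => (q + x)^-1) by [].
apply: is_derive_eq.
rewrite /GRing.scale/= /a; field.
by rewrite gt_eqF.
Qed.

(** The substitution [y = ypt q x], under which
    [1 - y ^+ 2 = (q ^+ 2 - 1) * a / (q + x) ^+ 2] and [y - x = a / (q + x)]. *)
Lemma half_torsion :
  (\int[mu]_(y in `[ypt Q x, 1%R]) (torsion s y * kern s (x, y))%:E =
   \int[mu]_(q in `[1%R, Q]) (a `^ (- s) * (q ^+ 2 - 1) `^ s / (q + x))%:E)%E.
Proof.
have yp1 : ypt 1 x = 1 by rewrite /ypt mul1r divff// gt_eqF// d0.
rewrite -[X in BRight X]yp1.
pose G y : R := torsion s y * kern s (x, y).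
pose dF q : R := - a * ((q + x) ^- 2).
have H := @substitution_decreasing R (fun q => ypt q x) dF G 1 Q Q1.
transitivity (\int[mu]_(q in `[1%R, Q]) (G (ypt q x) * - dF q)%:E)%E; first apply: H; last first.
- apply: eq_integral => q; rewrite inE/= in_itv/= => /andP[q1 _]; congr EFin.
  have dd := d0 q1; rewrite /G /dF.
  have q20 : 0 <= q ^+ 2 - 1 by rewrite subr_ge0 exprn_ege1.
  rewrite /torsion ypt_sqr// pos_powRE; last by rewrite !mulr_ge0 ?invr_ge0 ?exprn_ge0// ltW.
  rewrite /kern/= distrC ypt_sub// ger0_norm; last by rewrite divr_ge0// ltW.
  rewrite !powRM ?mulr_ge0 ?invr_ge0 ?exprn_ge0 ?(ltW a0) ?(ltW dd)//.
  have e1 : (q + x) ^- 2 = (q + x) `^ (- 2) by rewrite powR_invn// ltW.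
  have e2 : (q + x)^-1 = (q + x) `^ (- 1) by rewrite powR_inv1// ltW.
  rewrite e1 e2 -!powRrM.
  set A := (q ^+ 2 - 1) `^ s.
  have -> : a `^ (- s) = a `^ s * a `^ (- (1 + 2 * s)) * a.
    rewrite -[X in _ * X](powRr1 (ltW a0)) -!(powRD_gt0 _ _ a0).
    by congr (_ `^ _); ring.
  have -> : (q + x) `^ (- 1) = (q + x) `^ (- 2 * s) * (q + x) `^ (- 1 * - (1 + 2 * s)) * (q + x) `^ (- 2).
    by rewrite -!(powRD_gt0 _ _ dd); congr (_ `^ _); ring.
  ring.
- apply: continuous_in_subspaceT => y; rewrite inE/= in_itv/= => /andP[yq _].
  have xy : x < y by apply: lt_le_trans yq; apply: ypt_gt; exact: ltW.
  apply: cvgM; first exact: torsion_continuous.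
  apply: (@continuous_comp _ _ _ (fun y => `|x - y|) (fun t => t `^ _)).
    apply: (@continuous_comp _ _ _ (fun y : R => x - y) Num.norm); last exact: norm_continuous.
    by apply: cvgB; [exact: cvg_cst|exact: cvg_id].
  by apply: continuous_powR_gt0; rewrite normr_gt0 subr_eq0 lt_eqF.
- move=> q r; rewrite !in_itv/= => /andP[q1 _] /andP[r1 _] rq.
  have := ypt_sub q1; have := ypt_sub r1.
  have : a / (q + x) < a / (r + x).
    by rewrite ltr_pM2l// ltf_pV2 ?posrE ?d0// ltrD2r.
  by lra.
- move=> q /andP[q1 _]; apply: cvgMr.
  apply: cvgV; first by rewrite expf_neq0// gt_eqF// d0.
  apply: (@continuous_comp _ _ _ (fun q : R => q + x) (fun y => y ^+ 2)); last exact: exprn_continuous.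
  by apply: cvgD; [exact: cvg_id|exact: cvg_cst].
- by move=> q /andP[q1 _]; exact: ypt_derive.
Qed.

(** A primitive in [y] of the kernel is [- (2 * s)^-1 * (y - x) ^ (- 2 * s)]. *)
Lemma half_kern :
  (\int[mu]_(y in `[ypt Q x, +oo[) (kern s (x, y))%:E =
   (a `^ (- (2 * s)) * (Q + x) `^ (2 * s) / (2 * s))%:E)%E.
Proof.
pose F y : R := - (2 * s)^-1 * (y - x) `^ (- (2 * s)).
have dF y : x < y -> is_derive y 1 F ((y - x) `^ (- (1 + 2 * s))).
  move=> xy.
  have yx : 0 < y - x by rewrite subr_gt0.
  have h : is_derive y 1 (fun y => (y - x) `^ (- (2 * s))) (- (2 * s) * (y - x) `^ (- (2 * s) - 1)).
    have h1 := is_derive1_powR (- (2 * s)) yx.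
    have h2 : is_derive y 1 (fun y : R => y - x) 1.
      by apply: is_derive_eq; rewrite subr0.
    have := @is_derive1_comp _ (fun t => t `^ (- (2 * s))) (fun y : R => y - x) y _ _ h1 h2.
    by rewrite /GRing.scale/= mulr1.
  have -> : F = (- (2 * s)^-1) \*: (fun y => (y - x) `^ (- (2 * s))) by [].
  apply: is_derive_eq.
  have -> : - (1 + 2 * s) = - (2 * s) - 1 by ring.
  by rewrite /GRing.scale/=; field; rewrite gt_eqF.
have Q1' := ltW Q1.
have xQ := ypt_gt Q1'.
have F0 : F y @[y --> +oo] --> 0.
  rewrite -(mulr0 (- (2 * s)^-1)); apply: cvgMr.
  by apply: powR_shift_cvg0; rewrite mulr_gt0.
rewrite (@ge0_continuous_FTC2y _ _ F _ 0)//.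
- rewrite -EFinB sub0r /F ypt_sub// mulNr opprK; congr EFin.
  rewrite powRM ?invr_ge0 ?(ltW a0) ?(ltW (d0 Q1'))//.
  rewrite -(powR_inv1 (ltW (d0 Q1'))) -powRrM.
  have -> : - 1 * - (2 * s) = 2 * s by ring.
  by rewrite mulrC.
- by move=> y _; exact: kern_ge0.
- apply: continuous_in_subspaceT => y; rewrite inE/= in_itv/= andbT => yq.
  have xy : x < y by apply: lt_le_trans yq.
  apply: (@continuous_comp _ _ _ (fun y => `|x - y|) (fun t => t `^ _)).
    apply: (@continuous_comp _ _ _ (fun y : R => x - y) Num.norm); last exact: norm_continuous.
    by apply: cvgB; [exact: cvg_cst|exact: cvg_id].
  by apply: continuous_powR_gt0; rewrite normr_gt0 subr_eq0 lt_eqF.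
- by move=> y yq; have [] := dF y (lt_trans xQ yq).
- apply: cvg_at_right_filter; exact: (is_derive_continuous (dF _ xQ)).
- move=> y; rewrite in_itv/= andbT => yq; have xy := lt_trans xQ yq.
  by rewrite (is_derive1E (dF y xy)) /kern/= distrC gtr0_norm ?subr_gt0.
Qed.

End fixed_point.

End pseudo_hyperbolic.

(** * Bernoulli inequalities for real exponents *)

Section bernoulli.
Context {R : realType}.
Implicit Types s t p r : R.

(** Weighted arithmetic-geometric mean inequality for [t] and 1, by concavity of the
    logarithm at the mean [m = 1 + s * (t - 1)]. *)
Lemma bernoulli_powR s t : 0 <= s <= 1 -> 0 <= t -> t `^ s <= 1 + s * (t - 1).
Proof.
move=> /andP[s0 s1]; rewrite le_eqVlt => /predU1P[<-|t0].
  have [->|sn] := eqVneq s 0; first by rewrite powRr0 mul0r addr0.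
  by rewrite powR0//; lra.
have m0 : 0 < 1 + s * (t - 1) by nra.
rewrite -[leRHS](@lnK R) ?posrE// /powR gt_eqF// ler_expR.
set m := 1 + _.
have l (x : R) : 0 < x -> ln x <= x - 1.
  by move=> x0; have := @le_ln1Dx R (x - 1); rewrite addrCA subrr addr0; apply; lra.
have h1 := l _ (divr_gt0 t0 m0); have h2 := l _ (divr_gt0 ltr01 m0).
move: h1 h2; rewrite -/m.
rewrite !lnM ?posrE ?invr_gt0// !lnV ?posrE// ln1.
have hm : s * (t / m - 1) + (1 - s) * (1 / m - 1) = 0.
  by rewrite /m; field; rewrite gt_eqF.
by move: hm; set X := t / m; set Y := 1 / m; nra.
Qed.

(** Strictness comes from applying the weak inequality to the square root of [t] and
    squaring. *)
Lemma bernoulli_powR_lt s t : 0 < s < 1 -> 1 < t -> t `^ s < 1 + s * (t - 1).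
Proof.
move=> /andP[s0 s1] t1; have t0 := lt_trans ltr01 t1.
pose r := t `^ (1 / 2).
have r0 : 0 < r by exact: powR_gt0.
have tE : t = r ^+ 2 by rewrite -powR_mulrn ?(ltW r0)// -powRrM mul1r mulVf// powRr1// ltW.
have r1 : 1 < r by rewrite -(@ltr_pXn2r _ 2)// ?nnegrE ?(ltW r0)// expr1n -tE.
have -> : t `^ s = (r `^ s) ^+ 2 by rewrite tE !expr2 powRM ?(ltW r0).
have h : r `^ s <= 1 + s * (r - 1).
  by apply: bernoulli_powR; rewrite ?(ltW s0) ?(ltW s1) ?(ltW r0).
have q0 : 0 <= r `^ s by exact: powR_ge0.
have : (r `^ s) ^+ 2 <= (1 + s * (r - 1)) ^+ 2 by rewrite ler_pXn2r ?nnegrE//; nra.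
move/le_lt_trans; apply; rewrite tE.
rewrite -subr_gt0.
have -> : 1 + s * (r ^+ 2 - 1) - (1 + s * (r - 1)) ^+ 2 = s * (1 - s) * (r - 1) ^+ 2 by ring.
by rewrite !mulr_gt0 ?subr_gt0// exprn_gt0// subr_gt0.
Qed.

Lemma bernoulli_powR_ge p r : 1 <= p -> 0 <= r -> 1 + p * (r - 1) <= r `^ p.
Proof.
move=> p1 r0; have p0 := lt_le_trans ltr01 p1.
have := @bernoulli_powR p^-1 (r `^ p).
rewrite invr_ge0 (ltW p0) invf_le1// p1 powR_ge0 -powRrM mulfV ?gt_eqF// powRr1//.
move=> /(_ erefl erefl) h.
have : p * r <= p * (1 + p^-1 * (r `^ p - 1)) by rewrite ler_pM2l.
by rewrite mulrDr mulrA mulfV ?gt_eqF// mul1r mulr1; lra.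
Qed.

End bernoulli.

Lemma is_derive_sqr_affine {R : realType} (a q : R) :
  is_derive q 1 (fun q : R => (q ^+ 2 - 1) / a) (2 * q / a).
Proof.
have -> : (fun q : R => (q ^+ 2 - 1) / a) = a^-1 \*: (fun q : R => q ^+ 2 - 1).
  by apply/funext => r; rewrite /GRing.scale/= mulrC.
apply: is_derive_eq.
by rewrite /GRing.scale/= ?mul1r ?mulr1; ring.
Qed.

(** * The truncated operator applied to the torsion function *)

Section far_integrals.
Context {R : realType}.
Local Notation mu := (@lebesgue_measure R).
Local Notation mu2 := (mu \x mu)%E.
Implicit Types (x y q : R) (z : R * R).
Variables (s Q : R).
Hypotheses (s01 : 0 < s < 1) (Q1 : 1 < Q).
Let s0 : 0 < s. Proof. by case/andP: s01. Qed.
Let s1 : s < 1. Proof. by case/andP: s01. Qed.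

Lemma kernN x y : kern s (x, - y) = kern s (- x, y).
Proof. by rewrite /kern/= opprK -(normrN (x + y)) opprD. Qed.

Lemma mem_itv (i : interval R) y : (y \in ([set` i] : set R)) = (y \in i).
Proof. by apply/idP/idP; rewrite inE. Qed.

Lemma far_section x y : `|x| < 1 ->
  far Q (x, y) <-> ypt Q x < y \/ y < - ypt Q (- x).
Proof.
have Q1' := Q1; rewrite ltr_norml => /andP[x1 x2].
have d1 : 0 < Q + x by lra.
have d2 : 0 < Q - x by lra.
rewrite /far/= /ypt ltr_pdivrMr// -[in X in _ \/ X]mulNr ltr_pdivlMr//.
have [xy|yx] := leP x y.
- rewrite ler0_norm ?subr_le0//; split; first by move=> h; left; nra.
  by case=> h; nra.
- rewrite gtr0_norm ?subr_gt0//; split; first by move=> h; right; nra.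
  by case=> h; nra.
Qed.

Lemma measurable_far : measurable (far Q).
Proof.
have -> : far Q = (fun z : R * R => Q * `|z.1 - z.2| - (1 - z.1 * z.2)) @^-1` `]0, +oo[.
  by apply/seteqP; split => z /=; rewrite in_itv/= andbT subr_gt0.
rewrite -[X in measurable X]setTI.
have m : measurable_fun setT (fun z : R * R => Q * `|z.1 - z.2| - (1 - z.1 * z.2)).
  apply: measurable_funB.
    by apply: measurable_funM => //; apply: measurableT_comp => //; exact: measurable_funB.
  by apply: measurable_funB => //; exact: measurable_funM.
by apply: m => //; exact: measurable_itv.
Qed.

Local Open Scope ereal_scope.

Lemma integral_far x (h : R -> \bar R) : (`|x| < 1)%R ->
  measurable_fun setT h -> (forall y, 0 <= h y) ->
  \int[mu]_y ((\1_(far Q) (x, y))%:E * h y) =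
  \int[mu]_(y in `[ypt Q x, +oo[) h y + \int[mu]_(y in `[ypt Q (- x), +oo[) h (- y)%R.
Proof.
move=> x1 mh h0; have Q1' := Q1.
pose A := `]ypt Q x, +oo[%classic : set R.
pose B := `]-oo, (- ypt Q (- x))%R[%classic : set R.
have mA : measurable A by exact: measurable_itv.
have mB : measurable B by exact: measurable_itv.
have yx : (x < ypt Q x)%R by exact: ypt_gt (ltW Q1).
have yx' : (- x < ypt Q (- x))%R by apply: (ypt_gt _ (ltW Q1)); rewrite normrN.
have mhA : measurable_fun setT (h \_ A).
  by apply/(measurable_restrictT _ mA); exact: measurable_funS mh.
have mhB : measurable_fun setT (h \_ B).
  by apply/(measurable_restrictT _ mB); exact: measurable_funS mh.
transitivity (\int[mu]_y ((h \_ A) y + (h \_ B) y)).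
  apply: eq_integral => y _; rewrite indicE !patchE.
  have hA : (y \in A) = (ypt Q x < y)%R by rewrite /A mem_itv in_itv/= andbT.
  have hB : (y \in B) = (y < - ypt Q (- x))%R by rewrite /B mem_itv in_itv/=.
  rewrite hA hB; case: (boolP ((x, y) \in far Q)) => [|hn].
    rewrite inE far_section// => -[h1|h1]; rewrite h1 mul1e.
    - by case: ifPn => [h2|]; [exfalso; lra|rewrite adde0].
    - by case: ifPn => [h2|]; [exfalso; lra|rewrite add0e].
  have /not_orP[/negP/negbTE -> /negP/negbTE ->] : ~ (ypt Q x < y \/ y < - ypt Q (- x))%R.
    by move/far_section => /(_ x1) /mem_set; apply/negP.
  by rewrite mul0e adde0.
rewrite ge0_integralD//; last 2 first.
- by move=> y _; exact: erestrict_ge0.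
- by move=> y _; exact: erestrict_ge0.
congr (_ + _).
  by rewrite -integral_mkcond integral_itv_obnd_cbnd//; exact: measurable_funS mh.
rewrite (@ge0_integral_dilation _ (- 1)%R)//; last 1 first.
- by move=> y; exact: erestrict_ge0.
rewrite normrN normr1 mul1e.
have mhN : measurable_fun setT (fun y => h (- y)%R).
  by apply: (measurableT_comp mh).
transitivity (\int[mu]_(y in `]ypt Q (- x), +oo[) h (- y)%R); last first.
  by rewrite integral_itv_obnd_cbnd//; exact: measurable_funS mhN.
rewrite [RHS]integral_mkcond; apply: eq_integral => y _.
rewrite !patchE mulN1r.
suff -> : ((- y)%R \in B) = (y \in `]ypt Q (- x), +oo[%classic) by [].
by rewrite /B !mem_itv !in_itv/= andbT ltrNr opprK.
Qed.

Lemma far_kern x : (`|x| < 1)%R ->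
  \int[mu]_y (\1_(far Q) (x, y) * kern s (x, y))%:E =
  ((1 - x ^+ 2) `^ (- (2 * s)) * ((Q + x) `^ (2 * s) + (Q - x) `^ (2 * s)) / (2 * s))%:E.
Proof.
move=> x1; under eq_integral do rewrite EFinM.
have mk x' : measurable_fun setT (fun y : R => (kern s (x', y))%:E).
  apply/measurable_EFinP; apply: (measurableT_comp (measurable_kern s)).
  exact: pair1_measurable.
rewrite (integral_far (h := fun y => (kern s (x, y))%:E))//; last first.
  by move=> y; rewrite lee_fin kern_ge0.
rewrite half_kern//.
have -> : \int[mu]_(y in `[ypt Q (- x), +oo[) (kern s (x, - y)%R)%:E =
          \int[mu]_(y in `[ypt Q (- x), +oo[) (kern s (- x, y)%R)%:E.
  by apply: eq_integral => y _; rewrite kernN.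
rewrite half_kern ?normrN// sqrrN -EFinD; congr EFin.
by rewrite mulrDr mulrDl.
Qed.

Lemma half_torsion_ray x : (`|x| < 1)%R ->
  \int[mu]_(y in `[ypt Q x, +oo[) (torsion s y * kern s (x, y))%:E =
  \int[mu]_(q in `[1%R, Q]) ((1 - x ^+ 2) `^ (- s) * (q ^+ 2 - 1) `^ s / (q + x))%:E.
Proof.
move=> x1; rewrite -half_torsion// integral_mkcond [RHS]integral_mkcond.
apply: eq_integral => y _; rewrite !patchE.
have hA : (y \in (`[ypt Q x, +oo[%classic : set R)) = (ypt Q x <= y)%R.
  by rewrite mem_itv in_itv/= andbT.
have hB : (y \in (`[ypt Q x, 1%R]%classic : set R)) = (ypt Q x <= y <= 1)%R.
  by rewrite mem_itv in_itv.
rewrite hA hB; case: (leP (ypt Q x) y) => //= h1.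
case: (leP y 1%R) => // h2.
by rewrite torsion_eq0 ?mul0r// ger0_norm; lra.
Qed.

(** The two halves of [half_torsion], for [x] and [- x], add up through
    [(q + x)^-1 + (q - x)^-1 = 2 * q / (q ^+ 2 - x ^+ 2)]; as
    [q ^+ 2 - x ^+ 2 = (q ^+ 2 - 1) + (1 - x ^+ 2)], the substitution
    [t = (q ^+ 2 - 1) / (1 - x ^+ 2)] turns the sum into the density
    [t ^ s / (1 + t)]. *)
Lemma far_torsion x : (`|x| < 1)%R ->
  \int[mu]_y (\1_(far Q) (x, y) * (torsion s y * kern s (x, y)))%:E =
  (pint s ((Q ^+ 2 - 1) / (1 - x ^+ 2)))%:E.
Proof.
move=> x1; under eq_integral do rewrite EFinM.
have mk x' : measurable_fun setT (fun y : R => (torsion s y * kern s (x', y))%:E).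
  apply/measurable_EFinP; apply: measurable_funM.
    by apply: continuous_measurable; exact: torsion_continuous.
  apply: (measurableT_comp (measurable_kern s)).
  exact: pair1_measurable.
rewrite (integral_far (h := fun y => (torsion s y * kern s (x, y))%:E))//; last first.
  by move=> y; rewrite lee_fin mulr_ge0 ?kern_ge0 ?torsion_ge0.
rewrite half_torsion_ray//.
have -> : \int[mu]_(y in `[ypt Q (- x), +oo[) (torsion s (- y) * kern s (x, - y)%R)%:E =
          \int[mu]_(y in `[ypt Q (- x), +oo[) (torsion s y * kern s (- x, y)%R)%:E.
  by apply: eq_integral => y _; rewrite torsionN kernN.
rewrite half_torsion_ray ?normrN// sqrrN.
have a0 := abs_lt1 x1.
set a : R := (1 - x ^+ 2)%R in a0 *.
have Q1' := Q1; have [xl xr] : (-1 < x /\ x < 1)%R by move: x1; rewrite ltr_norml => /andP[].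
have m1 t : (-1 < t < 1)%R -> measurable_fun `[1%R, Q]
    (fun q : R => (a `^ (- s) * (q ^+ 2 - 1) `^ s / (q + t))%:E).
  move=> /andP[t1 t2]; apply/measurable_EFinP.
  apply: measurable_funM.
    apply: measurable_funM => //.
    apply: (measurableT_comp (measurable_powR _)) => //.
    by apply: measurable_funB => //; exact: exprn_measurable.
  apply: subspace_continuous_measurable_fun => //.
  apply: continuous_in_subspaceT => q; rewrite inE/= in_itv/= => /andP[q1 _].
  apply: cvgV; first by rewrite gt_eqF//; lra.
  by apply: cvgD; [exact: cvg_id|exact: cvg_cst].
have p1 t (q : R) : (-1 < t < 1)%R -> q \in `[1%R, Q] ->
    (0 <= (a `^ (- s) * (q ^+ 2 - 1) `^ s / (q + t))%:E)%E.
  rewrite in_itv/= => /andP[t1 t2] /andP[q1 _].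
  by rewrite lee_fin !mulr_ge0 ?powR_ge0// invr_ge0; lra.
rewrite -ge0_integralD//; last 4 first.
- by move=> q q1; apply: p1 => //; rewrite xl.
- by apply: m1; rewrite xl.
- by move=> q q1; apply: p1 => //; lra.
- by apply: m1; lra.
pose F (q : R) : R := ((q ^+ 2 - 1) / a)%R.
pose dF (q : R) : R := (2 * q / a)%R.
rewrite -pint_EFin//.
have -> : 0%R = F 1%R by rewrite /F expr1n subrr mul0r.
have -> : \int[mu]_(t in `[F 1%R, F Q]) (pden s t)%:E = \int[mu]_(q in `[1%R, Q]) (pden s (F q) * dF q)%:E.
  apply: (@substitution_increasing R F dF) => //.
  - by move=> q _; exact: is_derive_sqr_affine.
  - move=> q _; apply: cvgMl; apply: cvgMr; exact: cvg_id.
  - move=> q r; rewrite !in_itv/= => /andP[q1 _] /andP[r1 _] qr.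
    by rewrite /F ltr_pM2r ?invr_gt0// ltrD2r ltr_pXn2r ?nnegrE//; lra.
  - by apply: continuous_subspaceT; exact: pden_continuous.
apply: eq_integral => q; rewrite inE/= in_itv/= => /andP[q1 _].
rewrite -EFinD; congr EFin.
have q20 : (0 <= q ^+ 2 - 1)%R by rewrite subr_ge0 exprn_ege1.
have F0 : (0 <= F q)%R by rewrite divr_ge0// ltW.
rewrite /pden pos_powRE// max_l// /F powRM ?invr_ge0 ?(ltW a0)//.
have -> : (a^-1 `^ s = a `^ (- s))%R by rewrite -(powR_inv1 (ltW a0)) -powRrM mulN1r.
rewrite /dF; set A := (_ `^ s)%R; set B := (a `^ _)%R; rewrite /a; field.
apply/and4P; split; rewrite ?gt_eqF//; try lra.
by apply: (lt_le_trans a0); rewrite lerDl.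
Qed.

End far_integrals.

Section truncated_operator.
Context {R : realType}.
Implicit Types (x y q : R) (z : R * R).
Variables (s Q : R).
Hypotheses (s01 : 0 < s < 1) (Q1 : 1 < Q).

(** The integral of [kern s (x, y)] over the [y] with [far Q (x, y)], by [far_kern]. *)
Definition kern_mass x : R :=
  (1 - x ^+ 2) `^ (- (2 * s)) * ((Q + x) `^ (2 * s) + (Q - x) `^ (2 * s)) / (2 * s).

(** The integral of [(torsion s x - torsion s y) * kern s (x, y)] over the [y] with
    [far Q (x, y)], by [far_kern] and [far_torsion]. *)
Definition trunc_op x : R :=
  torsion s x * kern_mass x - pint s ((Q ^+ 2 - 1) / (1 - x ^+ 2)).

Lemma kern_mass_ge0 x : 0 <= kern_mass x.
Proof.
have /andP[s0 s1] := s01.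
by rewrite /kern_mass !mulr_ge0 ?powR_ge0 ?addr_ge0 ?powR_ge0// invr_ge0; lra.
Qed.

Lemma pint_ge0 n : 0 <= pint s n.
Proof. by apply: Rintegral_ge0 => x _; exact: pden_ge0. Qed.

(** With [a = 1 - x ^+ 2] and [N = Q ^+ 2 - 1], [trunc_op x] is
    [pfun s (N / a) + a ^ (- s) * e] where [e] is the excess of
    [((Q + x) ^ (2 * s) + (Q - x) ^ (2 * s)) / (2 * s)] over [N ^ s / s].  The first term is
    between [pfun s N] and [kappa s], and [e] is nonnegative and of order
    [N ^ (s - 1)].  Hence [trunc_op] tends to the constant [kappa s] as [Q] grows, with
    an error controlled by the integrable weight [a ^ (- s)]. *)
Lemma trunc_op_bounds x : `|x| < 1 ->
  pfun s (Q ^+ 2 - 1) <= trunc_op x <=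
  kappa s + 2 * (Q ^+ 2 - 1) `^ (s - 1) * (1 - x ^+ 2) `^ (- s).
Proof.
have /andP[s0 s1] := s01; have Q1' := Q1.
move=> x1; have a0 := abs_lt1 x1.
have [xl xr] : -1 < x /\ x < 1 by move: x1; rewrite ltr_norml => /andP[].
rewrite /trunc_op torsionE// /kern_mass.
set a : R := 1 - x ^+ 2 in a0 *; set N := Q ^+ 2 - 1.
have x21 : x ^+ 2 < 1 by rewrite -subr_gt0.
have a1 : a <= 1 by rewrite /a lerBlDr lerDl sqr_ge0.
have N0 : 0 < N by rewrite subr_gt0 exprn_egt1.
pose e := ((Q + x) `^ (2 * s) + (Q - x) `^ (2 * s)) / (2 * s) - N `^ s / s.
have sq (c : R) : 0 < c -> c `^ (2 * s) = (c ^+ 2) `^ s.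
  by move=> c0; rewrite -powR_mulrn ?(ltW c0)// -powRrM.
have LE : a `^ s * (a `^ (- (2 * s)) * ((Q + x) `^ (2 * s) + (Q - x) `^ (2 * s)) / (2 * s))
    - pint s (N / a) = a `^ (- s) * e + pfun s (N / a).
  have -> : a `^ (- (2 * s)) = a `^ (- s) * a `^ (- s).
    by rewrite -powRD_gt0//; congr (_ `^ _); ring.
  rewrite /pfun /e powRM ?invr_ge0 ?(ltW N0) ?(ltW a0)//.
  have -> : (a^-1) `^ s = a `^ (- s) by rewrite -(powR_inv1 (ltW a0)) -powRrM mulN1r.
  have h : a `^ s * a `^ (- s) = 1 by rewrite -powRD_gt0// subrr powRr0.
  set p := pint _ _; set Z := _ + _ `^ _.
  have -> : a `^ s * (a `^ (- s) * a `^ (- s) * Z / (2 * s)) = a `^ (- s) * (Z / (2 * s)).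
    by rewrite -!mulrA mulrA h mul1r.
  ring.
rewrite LE.
have p0 : 0 < Q + x by lra.
have m0 : 0 < Q - x by lra.
have e0 : 0 <= e.
  have sq2 (c : R) : 0 < c -> c `^ (2 * s) = (c `^ s) ^+ 2.
    by move=> c0; rewrite -powR_mulrn ?powR_ge0// -powRrM mulrC.
  have h : N `^ s <= (Q + x) `^ s * (Q - x) `^ s.
    rewrite -powRM ?(ltW p0) ?(ltW m0)//; apply: ge0_ler_powR; rewrite ?nnegrE ?(ltW s0) ?(ltW N0) ?mulr_ge0 ?(ltW p0) ?(ltW m0)//.
    by rewrite /N; nra.
  rewrite /e subr_ge0.
  have -> : N `^ s / s = (2 * N `^ s) / (2 * s) by field; rewrite gt_eqF.
  rewrite ler_pM2r ?invr_gt0 ?mulr_gt0// !sq2//.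
  have := sqr_ge0 ((Q + x) `^ s - (Q - x) `^ s).
  by move: h; set A := _ `^ s; set B := (Q + x) `^ s; set C := (Q - x) `^ s; nra.
have eN : e <= 2 * N `^ (s - 1).
  (* the tangent at [N] of the concave function [t ^ s], at [t = c ^+ 2] *)
  have hb (c : R) : 0 < c -> c `^ (2 * s) <= N `^ s + s * N `^ (s - 1) * (c ^+ 2 - N).
    move=> c0; rewrite sq//.
    have := @bernoulli_powR R s (c ^+ 2 / N).
    rewrite (ltW s0) (ltW s1) divr_ge0 ?sqr_ge0 ?(ltW N0)// => /(_ erefl erefl).
    rewrite powRM ?sqr_ge0 ?invr_ge0 ?(ltW N0)//.
    have -> : (N^-1) `^ s = (N `^ s)^-1 by rewrite -(powR_inv1 (ltW N0)) -powRrM mulN1r powRN.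
    rewrite ler_pdivrMr ?powR_gt0// => /le_trans; apply.
    have -> : N `^ s = N * N `^ (s - 1) by rewrite mulr_powRB1 ?(ltW N0).
    rewrite le_eqVlt; apply/orP; left; apply/eqP.
    by set M := N `^ _; field; rewrite gt_eqF.
  have h1 := hb _ p0; have h2 := hb _ m0.
  rewrite /e lerBlDr ler_pdivrMr ?mulr_gt0// (mulrDl (2 * N `^ (s - 1))).
  have -> : N `^ s / s * (2 * s) = 2 * N `^ s by field; rewrite gt_eqF.
  have : s * N `^ (s - 1) * ((Q + x) ^+ 2 - N) + s * N `^ (s - 1) * ((Q - x) ^+ 2 - N)
    <= 2 * N `^ (s - 1) * (2 * s).
    have -> : 2 * N `^ (s - 1) * (2 * s) = s * N `^ (s - 1) * 4 by ring.
    rewrite -mulrDr ler_wpM2l ?mulr_ge0 ?powR_ge0 ?(ltW s0)//.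
    by rewrite /N; nra.
  by lra.
have NA : N <= N / a by rewrite ler_pdivlMr// ler_piMr// ltW.
have Na0 : 0 <= N / a by rewrite divr_ge0// ltW.
apply/andP; split.
  apply: le_trans (pfun_nd s01 (ltW N0) NA) _.
  by rewrite lerDr mulr_ge0 ?powR_ge0.
rewrite addrC lerD//; first exact: pfun_le_kappa.
by rewrite mulrC ler_wpM2r ?powR_ge0.
Qed.

End truncated_operator.

(** * Exhaustion of the plane, and the weight at the end points *)

Section exhaustion.
Local Open Scope ereal_scope.
Context d (T : measurableType d) (R : realType) (mu : {measure set T -> \bar R}).
Variable F : (set T)^nat.
Hypotheses (ndF : nondecreasing_seq F) (mF : forall i, measurable (F i)).

Lemma ge0_integral_exhaustion_le (f : T -> \bar R) (C : \bar R) :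
  measurable_fun setT f -> (forall x, 0 <= f x) ->
  (forall n, \int[mu]_(x in F n) f x <= C) ->
  \int[mu]_(x in \bigcup_n F n) f x <= C.
Proof.
move=> mf f0 fC.
have h := @ge0_nondecreasing_set_cvg_integral _ _ _ F f mu ndF mF
  (fun i => measurable_funS measurableT (@subsetT _ _) mf) (fun i x _ => f0 x).
rewrite -(cvg_lim _ h)//; apply: lime_le; first by apply/cvg_ex; eexists; exact: h.
exact: nearW.
Qed.

Lemma cvg_integral_exhaustion (f : T -> R) : mu.-integrable setT (EFin \o f) ->
  (forall x, ~ (\bigcup_n F n) x -> f x = 0%R) ->
  \int[mu]_x (\1_(F n) x * f x)%:E @[n --> \oo] --> \int[mu]_x (f x)%:E.
Proof.
move=> iF f0; have mf := measurable_int _ iF.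
have /measurable_EFinP mf' := mf.
apply: (@dominated_cvg _ _ _ mu setT measurableT _ _ (fun x => (`|f x|)%:E)) => //.
- by move=> n; apply/measurable_EFinP; exact: measurable_funM.
- move=> x _; apply: cvg_near_cst; have [[n _ Fn]|/f0 ->] := pselect ((\bigcup_n F n) x); last first.
    by apply: nearW => n; rewrite mulr0.
  near=> m; rewrite indicE mem_set ?mul1r//.
  have nm : (n <= m)%N by near: m; exists n.
  by move: (ndF nm) => /subsetPset; apply.
- by have := integrable_norm iF.
- move=> n x _; rewrite lee_fin normrM ler_piMl//.
  by rewrite indicE; case: (_ \in _); rewrite ?normr1 ?normr0.
Unshelve. all: by end_near. Qed.

End exhaustion.

Lemma is_derive_powR_addl (R : realType) (r x : R) : 0 < 1 + x ->
  is_derive x 1 (fun x => (1 + x) `^ r) (r * (1 + x) `^ (r - 1)).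
Proof.
move=> h; have d1 := is_derive1_powR r h.
have e1 : is_derive x 1 (fun x : R => 1 + x) 1.
  by apply: is_derive_eq; rewrite add0r mul1r.
have := @is_derive1_comp _ (fun t => t `^ r) (fun x : R => 1 + x) x _ _ d1 e1.
by rewrite /GRing.scale/= mulr1.
Qed.

Lemma is_derive_powR_subl (R : realType) (r x : R) : 0 < 1 - x ->
  is_derive x 1 (fun x => (1 - x) `^ r) (- (r * (1 - x) `^ (r - 1))).
Proof.
move=> h; have d1 := is_derive1_powR r h.
have e1 : is_derive x 1 (fun x : R => 1 - x) (- 1).
  by apply: is_derive_eq; rewrite add0r mul1r.
have := @is_derive1_comp _ (fun t => t `^ r) (fun x : R => 1 - x) x _ _ d1 e1.
by rewrite /GRing.scale/= mulrN1.
Qed.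

Section singular_weight.
Context {R : realType}.
Local Notation mu := (@lebesgue_measure R).
Variable s : R.
Hypothesis s01 : 0 < s < 1.

(** An integrable majorant of [(1 - x ^+ 2) ^ (- s)] on (-1, 1) which, unlike the latter,
    has an elementary primitive. *)
Definition edge (x : R) : R := \1_(`]-1, 1[) x * ((1 - x) `^ (- s) + (1 + x) `^ (- s)).

Lemma edge_ge0 x : 0 <= edge x.
Proof. by rewrite mulr_ge0// addr_ge0// powR_ge0. Qed.

Lemma measurable_edge : measurable_fun setT edge.
Proof.
apply: measurable_funM; first exact: measurable_indic.
by apply: measurable_funD; apply: (measurableT_comp (measurable_powR _));
  [exact: measurable_funB|exact: measurable_funD].
Qed.

Lemma edge_integral_le (r : R) : 0 < r < 1 ->
  (\int[mu]_(x in `[(- r)%R, r]) ((1 - x) `^ (- s) + (1 + x) `^ (- s))%:E <= (4 / (1 - s))%:E)%E.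
Proof.
have /andP[s0 s1] := s01; move=> /andP[r0 r1].
pose F (x : R) : R := (1 - s)^-1 * ((1 + x) `^ (1 - s) - (1 - x) `^ (1 - s)).
have dF (x : R) : -1 < x < 1 -> is_derive x 1 F ((1 - x) `^ (- s) + (1 + x) `^ (- s)).
  move=> /andP[x1 x2].
  have h1 : 0 < 1 + x by lra.
  have h2 : 0 < 1 - x by lra.
  have c1 := is_derive_powR_addl (1 - s) h1; have c2 := is_derive_powR_subl (1 - s) h2.
  have -> : F = (1 - s)^-1 \*: ((fun x : R => (1 + x) `^ (1 - s)) -
    (fun x : R => (1 - x) `^ (1 - s))) by [].
  apply: is_derive_eq.
  have -> : 1 - s - 1 = - s by ring.
  rewrite /GRing.scale/=; field.
  by rewrite gt_eqF//; lra.
have LR : derivable_oo_LRcontinuous F (- r) r.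
  apply: (@derive_LRcontinuous _ F (fun x => (1 - x) `^ (- s) + (1 + x) `^ (- s))); first by lra.
  by move=> x /andP[h1 h2]; apply: dF; lra.
rewrite (@continuous_FTC2 _ _ F)//; [|lra| |].
- rewrite -EFinB lee_fin /F -mulrBr mulrC ler_pM2r ?invr_gt0; last by lra.
  rewrite !opprK.
  have h (t : R) : 0 <= t <= 2 -> 0 <= t `^ (1 - s) <= 2.
    move=> /andP[t0 t2]; rewrite powR_ge0/=.
    have := @bernoulli_powR R (1 - s) t; rewrite t0.
    have -> : 0 <= 1 - s <= 1 by lra.
    by move=> /(_ erefl erefl); nra.
  have := h (1 + r); have := h (1 - r).
  have -> : 0 <= 1 - r <= 2 by lra.
  have -> : 0 <= 1 + r <= 2 by lra.
  by move=> /(_ erefl)/andP[? ?] /(_ erefl)/andP[? ?]; lra.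
- apply: derivable_within_continuous => x; rewrite in_itv/= => /andP[h1 h2].
  have p1 : 0 < 1 + x by lra.
  have p2 : 0 < 1 - x by lra.
  have [c1 _] := is_derive_powR_addl (- s) p1; have [c2 _] := is_derive_powR_subl (- s) p2.
  exact: (derivableD c2 c1).
- by move=> x; rewrite in_itv/= => /andP[h1 h2]; rewrite (is_derive1E (dF x _))//; lra.
Qed.

Lemma edge_integrable : mu.-integrable setT (EFin \o edge).
Proof.
have /andP[s0 s1] := s01.
apply/integrableP; split; first by apply/measurable_EFinP; exact: measurable_edge.
apply: (@le_lt_trans _ _ (4 / (1 - s))%:E); last exact: ltry.
pose r n : R := 1 - n.+2%:R^-1.
have r01 n : 0 < r n < 1.
  by rewrite /r subr_gt0 gtrBl invr_gt0 ltr0n invf_lt1 ?ltr0n// ltr1n.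
have r_nd m n : (m <= n)%N -> r m <= r n.
  by move=> mn; rewrite lerD2l lerN2 lef_pV2 ?posrE ?ltr0n// ler_nat.
have sub n : (`[(- r n)%R, r n]%classic : set R) `<=` `]-1, 1[.
  move=> x /=; rewrite !in_itv/= => /andP[h1 h2]; have /andP[? ?] := r01 n; lra.
have me : measurable_fun setT (fun x => `|(EFin \o edge) x|%E).
  by apply: measurableT_comp => //; apply/measurable_EFinP; exact: measurable_edge.
have ndI : nondecreasing_seq (fun n => `[(- r n)%R, r n]%classic : set R).
  move=> m n mn; apply/subsetPset; apply: subset_itv; rewrite bnd_simp ?lerN2; exact: r_nd.
have h := @ge0_integral_exhaustion_le _ _ R mu _ ndI (fun n => measurable_itv _)
  _ (4 / (1 - s))%:E me (fun x => abse_ge0 _).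
have {}h := h _.
apply: le_trans (h _) => {h}.
- rewrite [leRHS]integral_mkcond le_eqVlt; apply/orP; left; apply/eqP.
  apply: eq_integral => x _; rewrite patchE; case: ifPn => //.
  rewrite notin_setE => xn /=; rewrite /edge indicE; case: (boolP (x \in _)) => [|_]; last by rewrite mul0r normr0.
  rewrite inE/= in_itv/= -ltr_norml => x1; exfalso; apply: xn.
  have [n nx] : exists n, `|x| <= r n.
    pose n := Num.truncn ((1 - `|x|)^-1).
    exists n; rewrite /r lerBrDl -lerBrDr.
    have h1 : 0 < 1 - `|x| by rewrite subr_gt0.
    rewrite invf_ple ?posrE ?ltr0n//.
    have := truncnS_gt ((1 - `|x|)^-1).
    move=> /ltW /le_trans; apply; rewrite ler_nat.
    by rewrite -/n.
  by exists n => //=; rewrite in_itv/= -ler_norml.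
- move=> n; apply: le_trans (edge_integral_le (r01 n)).
  rewrite le_eqVlt; apply/orP; left; apply/eqP.
  apply: eq_integral => x xr /=; rewrite ger0_norm ?edge_ge0//.
  rewrite /edge indicE mem_set ?mul1r//; apply: (sub n); exact/set_mem.
Qed.

End singular_weight.

(** * The truncated energy form against the torsion function *)

Section truncated_form.
Context {R : realType}.
Local Notation mu := (@lebesgue_measure R).
Local Notation mu2 := (mu \x mu)%E.
Implicit Types (x y : R) (z : R * R).
Variables (s : R).
Hypotheses (s01 : 0 < s < 1).
Let s0 : 0 < s. Proof. by case/andP: s01. Qed.

Definition flip z : R * R := (z.2, z.1).

Lemma measurable_flip : measurable_fun setT flip.
Proof. exact: measurable_swap. Qed.

Lemma ge0_integral_flip (f : R * R -> \bar R) : measurable_fun setT f ->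
  (forall z, 0 <= f z)%E -> (\int[mu2]_z f (flip z) = \int[mu2]_z f z)%E.
Proof.
move=> mf f0; rewrite (tonelli2 mf f0) tonelli1//.
by apply: (measurableT_comp mf); exact: measurable_flip.
Qed.

Lemma ge0_integrable (f : R * R -> R) : measurable_fun setT f ->
  (forall z, 0 <= f z) -> (\int[mu2]_z (f z)%:E < +oo)%E ->
  mu2.-integrable setT (fun z => (f z)%:E).
Proof.
move=> mf f0 foo; apply/integrableP; split; first exact/measurable_EFinP.
apply: le_lt_trans foo; rewrite le_eqVlt; apply/orP; left; apply/eqP.
by apply: eq_integral => z _; rewrite gee0_abs// lee_fin.
Qed.

Lemma far_flip Q z : \1_(far Q) (flip z) = \1_(far Q) z :> R.
Proof.
rewrite !indicE; congr (_%:R); congr nat_of_bool.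
by apply/idP/idP; rewrite !inE /far/= distrC [X in 1 - X]mulrC.
Qed.

Lemma kern_flip z : kern s (flip z) = kern s z.
Proof. by case: z => x y; rewrite /flip/= kern_sym. Qed.

Lemma far_outside Q x y : 1 < Q -> 1 <= `|x| -> `|y| < 1 -> far Q (x, y).
Proof.
move=> Q1; rewrite ler_normr ltr_norml /far/= => x1 /andP[y1 y2].
case/orP: x1 => x1.
- have : 0 < x - y by lra.
  by move=> h; rewrite gtr0_norm//; nra.
- have : x - y < 0 by lra.
  by move=> h; rewrite ltr0_norm//; nra.
Qed.

Definition ext : set R := [set x | 1 <= `|x|].

Lemma measurable_ext : measurable ext.
Proof.
have -> : ext = ~` `]-1, 1[%classic.
  by apply/seteqP; split => x; rewrite /ext/= in_itv/= -ltr_norml leNgt => /negP.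
by apply: measurableC; exact: measurable_itv.
Qed.

Lemma ind_ext x : \1_ext x = (1 <= `|x|)%R%:R :> R.
Proof. by rewrite indicE; congr (_%:R); congr nat_of_bool; apply/idP/idP; rewrite inE. Qed.

Lemma ind_int x : \1_(`]-1, 1[) x = (`|x| < 1)%R%:R :> R.
Proof. by rewrite indicE mem_itv in_itv/= -ltr_norml. Qed.

(** The energy between the outside of (-1, 1), where [w] is evaluated, and the torsion
    function inside.  In [form_torsion] it accounts for the values of [w] outside
    (-1, 1), where the fractional Laplacian of the torsion function is not constant. *)
Definition tail w z : R := \1_ext z.1 * (w z.1 * torsion s z.2 * kern s z).

Definition interaction w : R := \int[mu2]_z tail w z.

Lemma measurable_torsion : measurable_fun setT (torsion s).
Proof. by apply: continuous_measurable; exact: torsion_continuous. Qed.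

Lemma Rintegral_subE d (T : measurableType d) (m : {measure set T -> \bar R})
    (f g h : T -> R) : (forall t : T, f t - g t = h t) ->
  m.-integrable setT (EFin \o f) -> m.-integrable setT (EFin \o g) ->
  m.-integrable setT (EFin \o h) /\
  \int[m]_t h t = \int[m]_t f t - \int[m]_t g t.
Proof.
move=> fgh fi gi; have <- : (fun t => f t - g t) = h by apply/funext.
split; last by rewrite RintegralB.
exact: (integrableB measurableT fi gi).
Qed.

Lemma Rintegral_addE d (T : measurableType d) (m : {measure set T -> \bar R})
    (f g h : T -> R) : (forall t : T, f t + g t = h t) ->
  m.-integrable setT (EFin \o f) -> m.-integrable setT (EFin \o g) ->
  m.-integrable setT (EFin \o h) /\
  \int[m]_t h t = \int[m]_t f t + \int[m]_t g t.
Proof.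
move=> fgh fi gi; have <- : (fun t => f t + g t) = h by apply/funext.
split; last by rewrite RintegralD.
exact: (integrableD measurableT fi gi).
Qed.

Definition trunc_density Q w x : R := \1_(`]-1, 1[) x * (w x * trunc_op s Q x).

Section fixed_radius.
Variables (Q : R) (w : R -> R) (B : R).
Hypotheses (Q1 : 1 < Q) (mw : measurable_fun setT w) (w0 : forall x, 0 <= w x).
Hypothesis wB : forall x, w x <= B.

(** Up to the exchange of [z.1] and [z.2], the truncated form is the integral of
    [fX - fY].  Here [fZ] is the part of [fY] with [z.1] in (-1, 1), the other part being
    [tail w], and [gX], [gP] are the integrals of [fX], [fZ] over [z.2]. *)
Let fX z : R := \1_(far Q) z * (w z.1 * torsion s z.1 * kern s z).
Let fY z : R := \1_(far Q) z * (w z.1 * torsion s z.2 * kern s z).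
Let fZ z : R := \1_(`]-1, 1[) z.1 * fY z.
Let gX x : R := w x * torsion s x * kern_mass s Q x.
Let gP x : R := \1_(`]-1, 1[) x * (w x * pint s ((Q ^+ 2 - 1) / (1 - x ^+ 2))).

Lemma measurable_tail : measurable_fun setT (tail w).
Proof.
apply: measurable_funM.
  by apply: measurable_proj1; apply: measurable_indic; exact: measurable_ext.
apply: measurable_funM; last exact: measurable_kern.
by apply: measurable_funM; [exact: measurable_proj1|apply: measurable_proj2; exact: measurable_torsion].
Qed.

Lemma tail_ge0 z : 0 <= tail w z.
Proof. by rewrite !mulr_ge0 ?torsion_ge0 ?kern_ge0. Qed.

Let mfX : measurable_fun setT fX.
Proof.
apply: measurable_funM; first by apply: measurable_indic; exact: measurable_far.
apply: measurable_funM; last exact: measurable_kern.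
by apply: measurable_funM; apply: measurable_proj1 => //; exact: measurable_torsion.
Qed.

Let mfY : measurable_fun setT fY.
Proof.
apply: measurable_funM; first by apply: measurable_indic; exact: measurable_far.
apply: measurable_funM; last exact: measurable_kern.
by apply: measurable_funM; [exact: measurable_proj1|apply: measurable_proj2; exact: measurable_torsion].
Qed.

Let mfZ : measurable_fun setT fZ.
Proof. by apply: measurable_funM => //; apply: measurable_proj1; exact: measurable_indic. Qed.

Let fX0 z : 0 <= fX z. Proof. by rewrite !mulr_ge0 ?torsion_ge0 ?kern_ge0. Qed.
Let fY0 z : 0 <= fY z. Proof. by rewrite !mulr_ge0 ?torsion_ge0 ?kern_ge0. Qed.
Let fZ0 z : 0 <= fZ z. Proof. by rewrite mulr_ge0. Qed.

Let measurable_section (f : R -> R) x : measurable_fun setT f ->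
  measurable_fun setT (fun y => (\1_(far Q) (x, y) * (f y * kern s (x, y)))%:E).
Proof.
move=> mf; apply/measurable_EFinP; apply: measurable_funM.
  have mi : measurable_fun setT (\1_(far Q) : R * R -> R).
    by apply: measurable_indic; exact: measurable_far.
  by apply: (measurableT_comp mi).
by apply: measurable_funM => //; apply: (measurableT_comp (measurable_kern s)).
Qed.

Let int_fX x : (\int[mu]_y (fX (x, y))%:E = (gX x)%:E)%E.
Proof.
rewrite /fX /gX /=; have [x1|x1] := ltP `|x| 1; last first.
  rewrite torsion_eq0// mulr0 !mul0r.
  by under eq_integral do rewrite mul0r mulr0; rewrite integral0.
under eq_integral do rewrite mulrCA EFinM.
rewrite ge0_integralZl//.
- by rewrite far_kern// -EFinM.
- have := measurable_section x (measurable_cst (1 : R)).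
  by apply: eq_measurable_fun => y _; rewrite mul1r.
- by move=> y _; rewrite lee_fin mulr_ge0 ?kern_ge0.
- by rewrite lee_fin mulr_ge0 ?torsion_ge0.
Qed.

Let int_fZ x : (\int[mu]_y (fZ (x, y))%:E = (gP x)%:E)%E.
Proof.
rewrite /fZ /fY /gP /= !ind_int; have [x1|x1] := ltP `|x| 1; last first.
  by rewrite !mul0r; under eq_integral do rewrite mul0r; rewrite integral0.
under eq_integral do rewrite !mul1r -mulrA mulrCA EFinM.
rewrite mul1r ge0_integralZl//.
- by rewrite far_torsion// -EFinM.
- exact: (measurable_section x measurable_torsion).
- by move=> y _; rewrite lee_fin !mulr_ge0 ?kern_ge0 ?torsion_ge0.
- by rewrite lee_fin.
Qed.

Let fY_split z : fY z = fZ z + tail w z.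
Proof.
case: z => x y; rewrite /fZ /tail /= ind_int ind_ext.
have [x1|x1] := ltP `|x| 1; first by rewrite mul1r mul0r addr0.
rewrite mul0r mul1r add0r /fY/=.
have [y1|y1] := ltP `|y| 1; last by rewrite torsion_eq0// !(mulr0, mul0r).
by rewrite indicE mem_set ?mul1r//; exact: far_outside.
Qed.

Let mgX : measurable_fun setT gX.
Proof.
apply/measurable_EFinP.
have := @measurable_tonelli1 R (fun z => (fX z)%:E).
have -> : (fun x : R => \int[mu]_y (fX (x, y))%:E)%E = EFin \o gX.
  by apply/funext => x; rewrite int_fX.
by apply=> //; exact/measurable_EFinP.
Qed.

Let mgP : measurable_fun setT gP.
Proof.
apply/measurable_EFinP.
have := @measurable_tonelli1 R (fun z => (fZ z)%:E).
have -> : (fun x : R => \int[mu]_y (fZ (x, y))%:E)%E = EFin \o gP.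
  by apply/funext => x; rewrite int_fZ.
by apply=> //; exact/measurable_EFinP.
Qed.

Lemma powR_le_edge x : `|x| < 1 -> (1 - x ^+ 2) `^ (- s) <= edge s x.
Proof.
move=> x1; have a0 := abs_lt1 x1; rewrite /edge ind_int x1 mul1r.
have [xl xr] : -1 < x /\ x < 1 by move: x1; rewrite ltr_norml => /andP[].
have [xp|xn] := leP 0 x.
- apply: (@le_trans _ _ ((1 - x) `^ (- s))); last by rewrite lerDl powR_ge0.
  rewrite !powRN lef_pV2 ?posrE ?powR_gt0//; last lra.
  by apply: ge0_ler_powR; rewrite ?nnegrE ?(ltW s0) ?(ltW a0)//; nra.
- apply: (@le_trans _ _ ((1 + x) `^ (- s))); last by rewrite lerDr powR_ge0.
  rewrite !powRN lef_pV2 ?posrE ?powR_gt0//; last lra.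
  by apply: ge0_ler_powR; rewrite ?nnegrE ?(ltW s0) ?(ltW a0)//; nra.
Qed.

Let gX0 x : 0 <= gX x.
Proof.
apply: mulr_ge0; last exact: (@kern_mass_ge0 R s Q s01).
by rewrite mulr_ge0 ?torsion_ge0.
Qed.

Let gP0 x : 0 <= gP x.
Proof. by rewrite !mulr_ge0 ?pint_ge0. Qed.

Local Notation gL := (trunc_density Q w).

Let gXP x : gX x - gP x = gL x.
Proof.
rewrite /gX /gP /trunc_density ind_int; have [x1|x1] := ltP `|x| 1; last first.
  by rewrite torsion_eq0// mulr0 !mul0r subrr.
by rewrite mulr1n !mul1r mulrBr -mulrA.
Qed.

Lemma trunc_op_ge0 x : `|x| < 1 -> 0 <= trunc_op s Q x.
Proof.
move=> /(trunc_op_bounds s01 Q1)/andP[+ _]; apply: le_trans.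
by apply: pfun_ge0 => //; rewrite subr_ge0 exprn_ege1// ltW.
Qed.

Let gL0 x : 0 <= gL x.
Proof.
rewrite /trunc_density ind_int; have [x1|x1] := ltP `|x| 1; last by rewrite mul0r.
by rewrite mul1r mulr_ge0 ?trunc_op_ge0.
Qed.

(** [torsion s x * kern_mass s Q x] is of order [(1 - x ^+ 2) ^ (- s)]. *)
Let igX : mu.-integrable setT (EFin \o gX).
Proof.
pose C := ((Q + 1) `^ (2 * s) + (Q + 1) `^ (2 * s)) / (2 * s).
have C0 : 0 <= C by rewrite mulr_ge0 ?addr_ge0 ?powR_ge0// invr_ge0 mulr_ge0// ltW.
have B0 : 0 <= B by apply: le_trans (wB 0).
have := integrableZl measurableT (B * C) (edge_integrable s01).
apply: le_integrable => //; first exact/measurable_EFinP.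
move=> x _ /=; rewrite lee_fin ger0_norm// ger0_norm; last first.
  by apply: mulr_ge0; [exact: mulr_ge0|exact: edge_ge0].
rewrite /gX -mulrA -[leRHS]mulrA; apply: ler_pM => //.
  by apply: mulr_ge0; [exact: torsion_ge0|exact: (@kern_mass_ge0 R s Q s01)].
have [x1|x1] := ltP `|x| 1; last first.
  by rewrite torsion_eq0// mul0r; apply: mulr_ge0 => //; exact: edge_ge0.
have a0 := abs_lt1 x1.
have -> : torsion s x * kern_mass s Q x = (((Q + x) `^ (2 * s) + (Q - x) `^ (2 * s)) / (2 * s)) * (1 - x ^+ 2) `^ (- s).
  rewrite torsionE// /kern_mass.
  have -> : (1 - x ^+ 2) `^ (- s) = (1 - x ^+ 2) `^ s * (1 - x ^+ 2) `^ (- (2 * s)).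
    by rewrite -powRD_gt0//; congr (_ `^ _); ring.
  ring.
apply: ler_pM; rewrite ?powR_ge0//; last exact: powR_le_edge.
  by rewrite mulr_ge0 ?addr_ge0 ?powR_ge0// invr_ge0 mulr_ge0// ltW.
have [xl xr] : -1 < x /\ x < 1 by move: x1; rewrite ltr_norml => /andP[].
have Q1' := Q1; have s2 : 0 <= 2 * s by rewrite mulr_ge0// ltW.
rewrite ler_pM2r ?invr_gt0 ?mulr_gt0//; apply: lerD; apply: ge0_ler_powR => //; rewrite ?nnegrE; lra.
Qed.

Let igP : mu.-integrable setT (EFin \o gP).
Proof.
apply: le_integrable igX => //; first exact/measurable_EFinP.
move=> x _ /=; rewrite lee_fin !ger0_norm//.
by rewrite -subr_ge0 gXP.
Qed.

Hypothesis itail : mu2.-integrable setT (fun z => (tail w z)%:E).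

Let ifX : mu2.-integrable setT (fun z => (fX z)%:E).
Proof.
apply: ge0_integrable => //; rewrite tonelli1//; last exact/measurable_EFinP.
under eq_integral do rewrite int_fX.
have := integrable_fin_num measurableT igX.
by rewrite fin_numElt => /andP[].
Qed.

Let form_fX : \int[mu2]_z fX z = \int[mu]_x gX x.
Proof.
rewrite /Rintegral tonelli1//; last exact/measurable_EFinP.
by congr fine; apply: eq_integral => x _; exact: int_fX.
Qed.

Let ifZ : mu2.-integrable setT (fun z => (fZ z)%:E).
Proof.
apply: ge0_integrable => //; rewrite tonelli1//; last exact/measurable_EFinP.
under eq_integral do rewrite int_fZ.
have := integrable_fin_num measurableT igP.
by rewrite fin_numElt => /andP[].
Qed.

Let form_fZ : \int[mu2]_z fZ z = \int[mu]_x gP x.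
Proof.
rewrite /Rintegral tonelli1//; last exact/measurable_EFinP.
by congr fine; apply: eq_integral => x _; exact: int_fZ.
Qed.

Let ifY : mu2.-integrable setT (fun z => (fY z)%:E).
Proof.
by have [] := @Rintegral_addE _ _ mu2 fZ (tail w) fY (fun z => esym (fY_split z)) ifZ itail.
Qed.

Let form_fY : \int[mu2]_z fY z = \int[mu]_x gP x + interaction w.
Proof.
rewrite -form_fZ.
by have [] := @Rintegral_addE _ _ mu2 fZ (tail w) fY (fun z => esym (fY_split z)) ifZ itail.
Qed.

Let swap_integral (f : R * R -> R) : measurable_fun setT f ->
  (forall z, 0 <= f z) -> mu2.-integrable setT (fun z => (f z)%:E) ->
  mu2.-integrable setT (fun z => (f (flip z))%:E) /\
  \int[mu2]_z f (flip z) = \int[mu2]_z f z.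
Proof.
move=> mf f0 i; have e := @ge0_integral_flip (fun z => (f z)%:E) _ _.
have {}e : (\int[mu2]_z (f (flip z))%:E = \int[mu2]_z (f z)%:E)%E.
  by apply: e => //; exact/measurable_EFinP.
split; last by rewrite /Rintegral e.
apply: ge0_integrable => //.
  by apply: (measurableT_comp mf); exact: measurable_flip.
rewrite e; have := integrable_fin_num measurableT i.
by rewrite fin_numElt => /andP[].
Qed.

(** Gives, for [w] in the energy space, the integrability of [tail w] that the
    identities below take as a hypothesis. *)
Lemma far_weight_integrable :
  mu2.-integrable setT
    (fun z => (\1_(far Q) z * (w z.2 * torsion s z.2 * kern s z))%:E).
Proof.
have [iX _] := swap_integral mfX fX0 ifX; move: iX.
have -> // : (fun z => (fX (flip z))%:E) =
  (fun z => (\1_(far Q) z * (w z.2 * torsion s z.2 * kern s z))%:E).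
by apply/funext => z; rewrite /fX far_flip kern_flip.
Qed.

(** On [far Q] each of the four products in [dform s w (torsion s)] is integrable by
    itself; the form may therefore be unfolded and symmetrised before the integration
    over [z.2]. *)
Lemma truncated_formE :
  mu2.-integrable setT (fun z => (\1_(far Q) z * dform s w (torsion s) z)%:E) /\
  \int[mu2]_z (\1_(far Q) z * dform s w (torsion s) z) =
  2 * (\int[mu]_x gL x - interaction w).
Proof.
have [iX eX] := swap_integral mfX fX0 ifX; have [iY eY] := swap_integral mfY fY0 ifY.
have dE z : \1_(far Q) z * dform s w (torsion s) z =
    (fX z + fX (flip z)) - (fY z + fY (flip z)).
  rewrite /fX /fY !far_flip !kern_flip /dform /flip/=; ring.
have [iXX eXX] := @Rintegral_addE _ _ mu2 fX (fX \o flip) _ (fun _ => erefl) ifX iX.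
have [iYY eYY] := @Rintegral_addE _ _ mu2 fY (fY \o flip) _ (fun _ => erefl) ifY iY.
have [iD eD] := @Rintegral_subE _ _ mu2 _ _ (fun z => \1_(far Q) z * dform s w (torsion s) z) (fun z => esym (dE z)) iXX iYY.
split; first exact: iD.
have [_ eL] := @Rintegral_subE _ _ mu gX gP gL gXP igX igP.
move: eX eY eXX eYY; rewrite /comp => eX eY eXX eYY.
rewrite eD eXX eYY eX eY form_fX form_fY eL.
set A := Rintegral _ _ _; set P := Rintegral _ _ _; clearbody A P.
ring.
Qed.

Lemma trunc_integral_bounds :
  mu.-integrable setT (fun x => (\1_(`]-1, 1[) x * w x)%:E) /\
  pfun s (Q ^+ 2 - 1) * \int[mu]_x (\1_(`]-1, 1[) x * w x) <= \int[mu]_x gL x <=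
  kappa s * \int[mu]_x (\1_(`]-1, 1[) x * w x)
  + 2 * (Q ^+ 2 - 1) `^ (s - 1) * (B * \int[mu]_x edge s x).
Proof.
have B0 : 0 <= B by apply: le_trans (wB 0).
have iw : mu.-integrable setT (fun x => (\1_(`]-1, 1[) x * w x)%:E).
  have := integrableZl measurableT B (edge_integrable s01).
  apply: le_integrable => //.
    by apply/measurable_EFinP; apply: measurable_funM => //; exact: measurable_indic.
  move=> x _ /=; rewrite lee_fin ger0_norm; last exact: mulr_ge0.
  rewrite ger0_norm; last by apply: mulr_ge0 => //; exact: edge_ge0.
  rewrite /edge mulrCA ind_int; have [x1|x1] := ltP `|x| 1; last by rewrite !mul0r.
  rewrite !mul1r -[leLHS]mulr1 ler_pM//.
  have := powR_le_edge x1; rewrite /edge ind_int x1 mul1r; apply: le_trans.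
  have a0 := abs_lt1 x1; rewrite powRN invf_ge1 ?powR_gt0//.
  by rewrite -torsionE// torsion_le1.
have [igL _] := @Rintegral_subE _ _ mu gX gP gL gXP igX igP.
split=> //; apply/andP; split.
  rewrite -RintegralZl//; apply: le_Rintegral => //; first exact: (integrableZl measurableT _ iw).
  move=> x _; rewrite /trunc_density ind_int; have [x1|x1] := ltP `|x| 1; last by rewrite !mul0r mulr0.
  rewrite !mul1r mulrC ler_wpM2l//.
  by have /andP[] := trunc_op_bounds s01 Q1 x1.
have ie := edge_integrable s01.
rewrite -RintegralZl// -(RintegralZl _ measurableT ie) -RintegralZl//; last exact: (integrableZl measurableT B ie).
rewrite -RintegralD//; last 2 first.
- exact: (integrableZl measurableT _ iw).
- exact: (integrableZl measurableT _ (integrableZl measurableT B ie)).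
apply: le_Rintegral => //.
  have := integrableD measurableT (integrableZl measurableT (kappa s) iw)
    (integrableZl measurableT (2 * (Q ^+ 2 - 1) `^ (s - 1)) (integrableZl measurableT B ie)).
  by [].
move=> x _; rewrite /trunc_density ind_int; have [x1|x1] := ltP `|x| 1; last first.
  rewrite !mul0r mulr0 add0r; apply: mulr_ge0; first by rewrite mulr_ge0 ?powR_ge0.
  by apply: mulr_ge0 => //; exact: edge_ge0.
rewrite !mul1r.
have /andP[_ h] := trunc_op_bounds s01 Q1 x1.
apply: (le_trans (ler_wpM2l (w0 x) h)).
rewrite mulrDr (mulrC (w x)) lerD2l mulrCA ler_wpM2l ?mulr_ge0 ?powR_ge0//.
by apply: ler_pM; rewrite ?powR_ge0 ?powR_le_edge.
Qed.

End fixed_radius.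

End truncated_form.

(** * The torsion function has a constant fractional Laplacian *)

Section torsion_identity.
Context {R : realType}.
Local Notation mu := (@lebesgue_measure R).
Local Notation mu2 := (mu \x mu)%E.
Implicit Types (x y b : R) (z : R * R) (w : R -> R).
Variables (s : R).
Hypotheses (s01 : 0 < s < 1).
Let s0 : 0 < s. Proof. by case/andP: s01. Qed.

Definition radius n : R := n%:R + 2.

Lemma radius_gt1 n : 1 < radius n.
Proof. by rewrite /radius; have := ler0n R n; lra. Qed.

(** The quantity [Q ^+ 2 - 1] of [trunc_op_bounds] along the exhaustion. *)
Definition radN n : R := radius n ^+ 2 - 1.

Lemma radN_ge n : n%:R + 1 <= radN n.
Proof. by rewrite /radN /radius; have := ler0n R n; nra. Qed.

Lemma far_nd : nondecreasing_seq (fun n => far (radius n)).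
Proof.
move=> m n mn; apply/subsetPset => z; rewrite /far/= => /lt_le_trans; apply.
by rewrite ler_wpM2r// lerD2r ler_nat.
Qed.

Lemma far_exhausts z : z.1 != z.2 -> (\bigcup_n far (radius n)) z.
Proof.
move=> z12; have d0 : 0 < `|z.1 - z.2| by rewrite normr_gt0 subr_eq0.
pose m := (1 - z.1 * z.2) / `|z.1 - z.2|.
exists (Num.truncn `|m|) => //; rewrite /far/= -ltr_pdivrMr// -/m.
have := truncnS_gt `|m|; have := ler_norm m.
by rewrite /radius -natr1; lra.
Qed.

Lemma dform_diag w phi z : ~ (\bigcup_n far (radius n)) z -> dform s w phi z = 0.
Proof.
move=> zn; have [e|/far_exhausts//] := eqVneq z.1 z.2.
by rewrite /dform e subrr !mul0r.
Qed.

Let T := torsion s.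
Let mass w := \int[mu]_x (\1_(`]-1, 1[) x * w x).

Lemma tail_torsion : tail s T = cst 0.
Proof.
apply/funext => z; rewrite /tail ind_ext; have [z1|z1] := leP 1 `|z.1|; last by rewrite mul0r.
by rewrite /T torsion_eq0// !(mulr0, mul0r).
Qed.

Lemma interaction_eq0 w : (forall x, 1 <= `|x| -> w x = 0) -> interaction s w = 0.
Proof.
move=> w0; rewrite /interaction.
have -> : tail s w = cst 0.
  apply/funext => z; rewrite /tail ind_ext; have [z1|z1] := leP 1 `|z.1|; last by rewrite mul0r.
  by rewrite w0// !(mulr0, mul0r).
by rewrite /Rintegral integral0.
Qed.

(** The truncated energies of the torsion function are given by [truncated_formE] with
    [w] the torsion function itself, and bounded by [trunc_op_bounds]; the sets [far Q]
    increase to a set that contains every pair off the diagonal. *)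
Lemma torsion_energy : energy_space s 1 T.
Proof.
have cT : continuous T by exact: torsion_continuous.
have mT := measurable_torsion s01.
split => //; first by move=> x; exact: torsion_eq0.
have it : mu2.-integrable setT (fun z => (tail s T z)%:E).
  by rewrite tail_torsion; exact: integrable0.
have T0 x : 0 <= T x by exact: torsion_ge0.
have T1 x : T x <= 1 by exact: torsion_le1.
pose C := 2 * (kappa s * mass T + 2 * (1 * \int[mu]_x edge s x)).
have E0 : 0 <= \int[mu]_x edge s x by apply: Rintegral_ge0 => x _; exact: edge_ge0.
have md : measurable_fun setT (fun z => (dform s T T z)%:E).
  by apply/measurable_EFinP; exact: measurable_dform.
apply: (@le_lt_trans _ _ C%:E); last exact: ltry.
rewrite gagliardoE.
have -> : (\int[mu2]_z (dform s T T z)%:E =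
    \int[mu2]_(z in \bigcup_n far (radius n)) (dform s T T z)%:E)%E.
  rewrite [RHS]integral_mkcond; apply: eq_integral => z _; rewrite patchE.
  by case: ifPn => //; rewrite notin_setE => zn; rewrite dform_diag.
apply: (@ge0_integral_exhaustion_le _ _ R mu2 (fun n => far (radius n)) far_nd
  (fun n => @measurable_far R (radius n)) _ _ md).
  by move=> z; rewrite lee_fin dform_ge0.
move=> n; have Q1 := radius_gt1 n.
have [i1 e1] := truncated_formE s01 Q1 mT T0 T1 it.
have [_ /andP[_ b2]] := trunc_integral_bounds s01 Q1 mT T0 T1.
have -> : (\int[mu2]_(z in far (radius n)) (dform s T T z)%:E =
    \int[mu2]_z (\1_(far (radius n)) z * dform s T T z)%:E)%E.
  rewrite integral_mkcond; apply: eq_integral => z _; rewrite patchE indicE.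
  by case: ifPn => _; rewrite ?mul1r ?mul0r.
rewrite -(fineK (integrable_fin_num measurableT i1)) lee_fin.
rewrite -/(Rintegral _ _ _) e1 interaction_eq0; last by move=> x; exact: torsion_eq0.
rewrite subr0 /C ler_pM2l//; apply: (le_trans b2).
rewrite lerD2l ler_wpM2r ?mul1r//.
rewrite -[leRHS]mulr1 ler_wpM2l//.
have N1 : 1 <= radN n by have := radN_ge n; have := ler0n R n; lra.
rewrite -[leRHS](powRr0 (radN n)).
by apply: ler_powR => //; have /andP[_ s1] := s01; lra.
Qed.

(** Where [1 <= `|z.1|], the torsion function vanishes at [z.1] and [tail s w z] is
    [w z.2 * torsion s z.2 * kern s z - dform s w (torsion s) z]; both terms are integrable
    on [far Q]. *)
Lemma tail_integrable b w : energy_space s b w -> (forall x, 0 <= w x) ->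
  mu2.-integrable setT (fun z => (tail s w z)%:E).
Proof.
move=> ew w0; have mw := energy_measurable ew.
have [M wM] := energy_bounded ew.
have wM' x : w x <= M by apply: le_trans (wM x); exact: ler_norm.
have iw := far_weight_integrable s01 (radius_gt1 0) mw w0 wM'.
have id := integrable_dform ew torsion_energy.
have := integrableD measurableT iw (integrable_norm id).
apply: le_integrable_fin; first exact: measurable_tail.
move=> z; rewrite ger0_norm ?tail_ge0// /tail ind_ext.
have f0 : 0 <= \1_(far (radius 0)) z * (w z.2 * torsion s z.2 * kern s z).
  by rewrite !mulr_ge0 ?torsion_ge0 ?kern_ge0.
have f1 := addr_ge0 f0 (normr_ge0 (dform s w T z)).
have [z1|z1] := leP 1 `|z.1|; last by rewrite mul0r.
rewrite mul1r; have [z2|z2] := ltP `|z.2| 1; last first.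
  by apply: le_trans f1; rewrite torsion_eq0// mulr0 mul0r.
have -> : \1_(far (radius 0)) z = 1 :> R.
  rewrite indicE mem_set//; have := far_outside (radius_gt1 0) z1 z2.
  by case: (z).
rewrite [leRHS]/=; have := ler_norm (- dform s w T z); rewrite normrN.
set A := `|_|; rewrite /dform /T torsion_eq0//; set k := kern _ _.
by rewrite mul1r; set t := torsion _ _; clearbody A k t; lra.
Qed.

Lemma radN_cvg : radN n `^ (s - 1) @[n --> \oo] --> 0.
Proof.
have s1 : 0 < 1 - s by have /andP[_] := s01; lra.
have h : (n%:R + 1) `^ (s - 1) @[n --> \oo] --> (0 : R).
  have -> : (fun n : nat => (n%:R + 1 : R) `^ (s - 1)) = (fun y : R => (y - (- 1)) `^ (- (1 - s))) \o (fun n => n%:R).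
    by apply/funext => n /=; rewrite opprK opprB.
  by apply: (cvg_comp _ _ (@cvgr_idn R)); exact: powR_shift_cvg0.
apply: (squeeze_cvgr _ (cvg_cst 0) h); apply: nearW => n.
rewrite powR_ge0/=; have n0 : 0 < n%:R + 1 :> R by have := ler0n R n; lra.
have -> : s - 1 = - (1 - s) by ring.
rewrite !powRN lef_pV2 ?posrE ?powR_gt0//; last by apply: lt_le_trans (radN_ge n).
by apply: ge0_ler_powR; rewrite ?nnegrE ?(ltW s1) ?(ltW n0) ?(le_trans (ltW n0) (radN_ge n)) ?radN_ge.
Qed.

Lemma pfun_cvg : pfun s (radN n) @[n --> \oo] --> kappa s.
Proof.
apply/cvgrPdist_lt => e e0; have [m m0 hm] := pfun_cvg_kappa s01 e0.
near=> n.
have N0 : 0 <= radN n by apply: le_trans (radN_ge n); have := ler0n R n; lra.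
rewrite ger0_norm ?subr_ge0 ?pfun_le_kappa// ltrBlDr -ltrBlDl.
apply: (lt_le_trans hm); apply: pfun_nd => //.
apply: le_trans (radN_ge n).
have : m <= n%:R by near: n; exact: nbhs_infty_ger.
by lra.
Unshelve. all: by end_near. Qed.

(** [kappa s] is, up to normalisation, the constant value on (-1, 1) of the fractional
    Laplacian of the torsion function.  The truncated forms converge to the left-hand
    side by dominated convergence, and [trunc_op_bounds] squeezes the right-hand
    side. *)
Lemma form_torsion b w : energy_space s b w -> (forall x, 0 <= w x) ->
  form s w T = 2 * (kappa s * mass w - interaction s w).
Proof.
move=> ew w0; have mw := energy_measurable ew.
have [M wM] := energy_bounded ew.
have wM' x : w x <= M by apply: le_trans (wM x); exact: ler_norm.
have it := tail_integrable ew w0.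
have id := integrable_dform ew torsion_energy.
pose c n := \int[mu]_x (trunc_density s (radius n) w x).
have cvc : 2 * (c n - interaction s w) @[n --> \oo] --> form s w T.
  have h := @cvg_integral_exhaustion _ _ R mu2 (fun n => far (radius n)) far_nd
    (fun n => @measurable_far R (radius n)) (dform s w T) id (@dform_diag w T).
  rewrite -(fineK (integrable_fin_num measurableT id)) in h.
  have -> : (fun n => 2 * (c n - interaction s w)) =
      (fun n => \int[mu2]_z (\1_(far (radius n)) z * dform s w T z)).
    apply/funext => n.
    by have [_ ->] := truncated_formE s01 (radius_gt1 n) mw w0 wM' it.
  exact: (fine_cvg h).
have cvk : c n @[n --> \oo] --> kappa s * mass w.
  pose E := M * \int[mu]_x edge s x.
  have hl : pfun s (radN n) * mass w @[n --> \oo] --> kappa s * mass w.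
    by apply: cvgMl; exact: pfun_cvg.
  have hr : kappa s * mass w + 2 * radN n `^ (s - 1) * E @[n --> \oo] --> kappa s * mass w.
    rewrite -[X in _ --> X]addr0; apply: cvgD; first exact: cvg_cst.
    rewrite -(mul0r E); apply: cvgMl; rewrite -(mulr0 2); apply: cvgMr; exact: radN_cvg.
  apply: (squeeze_cvgr _ hl hr); apply: nearW => n.
  by have [_] := trunc_integral_bounds s01 (radius_gt1 n) mw w0 wM'.
have : 2 * (c n - interaction s w) @[n --> \oo] --> 2 * (kappa s * mass w - interaction s w).
  by apply: cvgMr; apply: cvgB => //; exact: cvg_cst.
by move=> /(cvg_unique _ cvc); apply.
Qed.

Lemma interaction_le b b' w w' : energy_space s b w -> energy_space s b' w' ->
  (forall x, 0 <= w x) -> (forall x, 0 <= w' x) -> (forall x, 1 <= `|x| -> w x <= w' x) ->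
  interaction s w <= interaction s w'.
Proof.
move=> ew ew' w0 w0' ww; apply: le_Rintegral => //; [exact: (tail_integrable ew)|exact: (tail_integrable ew')|].
move=> z _; rewrite /tail ind_ext; have [z1|z1] := leP 1 `|z.1|; last by rewrite !mul0r.
by rewrite !mul1r ler_wpM2r ?kern_ge0// ler_wpM2r ?torsion_ge0// ww.
Qed.

Lemma interactionZ b w c : energy_space s b w -> (forall x, 0 <= w x) ->
  interaction s (fun x => c * w x) = c * interaction s w.
Proof.
move=> ew w0; rewrite /interaction -RintegralZl//; last exact: (tail_integrable ew).
by apply: eq_Rintegral => z _; rewrite /tail; ring.
Qed.

End torsion_identity.

(** * Dilation inequality and positivity at the origin *)

Section solutions.
Context {R : realType}.
Local Notation mu := (@lebesgue_measure R).
Local Notation mu2 := (mu \x mu)%E.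
Implicit Types (x y b l : R) (z : R * R) (w u G phi : R -> R).
Variables (s : R).
Hypotheses (s01 : 0 < s < 1).
Let s0 : 0 < s. Proof. by case/andP: s01. Qed.

Lemma gamma_const_ge0 : 0 <= gamma_const s.
Proof.
have g0 (t : R) : 0 <= euler_Gamma t.
  apply: fine_ge0; apply: integral_ge0 => x _.
  by rewrite lee_fin mulr_ge0 ?powR_ge0// expR_ge0.
rewrite /gamma_const !mulr_ge0 ?powR_ge0 ?(ltW s0)//.
by rewrite invr_ge0 mulr_ge0 ?powR_ge0.
Qed.

Lemma continuous_normr : continuous (fun x => `|x|).
Proof. exact: norm_continuous. Qed.

Lemma continuousM w phi : continuous w -> continuous phi ->
  continuous (fun x => w x * phi x).
Proof. by move=> cw cp x; apply: cvgM; [exact: cw|exact: cp]. Qed.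

(** With a zero constant the equation, tested with the torsion function, would force
    the integral of [`|x| * torsion s x] to vanish. *)
Lemma gamma_const_gt0 u : solves s (fun x => `|x|) u -> 0 < gamma_const s.
Proof.
move=> [eu /(_ _ (torsion_energy s01)) hu].
rewrite lt_neqAle gamma_const_ge0 andbT; apply/eqP => g0.
move: hu; rewrite -g0 !mul0r => /esym hu.
have /(_ 2^-1)/eqP : forall x, `|x| * torsion s x = 0.
  apply: (@Rintegral_continuous_le0 _ 1).
  - by apply: continuousM; [exact: continuous_normr|exact: torsion_continuous].
  - by move=> x; rewrite mulr_ge0 ?torsion_ge0.
  - by move=> x x1; rewrite torsion_eq0// mulr0.
  - by rewrite hu.
have h : `|2^-1 : R| < 1 by rewrite ger0_norm; lra.
by rewrite mulf_eq0 normr_eq0 invr_eq0 pnatr_eq0/= torsionE// gt_eqF// powR_gt0// abs_lt1.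
Qed.

Lemma solves_ge0 G u : 0 < gamma_const s -> solves s G u ->
  (forall x, `|x| < 1 -> 0 <= G x) -> forall x, 0 <= u x.
Proof.
move=> g0 [eu hu] G0; have [_ u0 _] := eu.
have upos x : 1 <= `|x| -> 0 <= u x by move=> /u0 ->.
apply: (weak_maximum_principle s0 eu upos).
have en := energy_neg_part eu upos; have [_ n0 _] := en.
have g2 : 0 < gamma_const s / 2 by rewrite divr_gt0.
rewrite -(pmulr_rge0 _ g2) hu//; apply: Rintegral_ge0 => x _.
have [x1|x1] := ltP `|x| 1; last by rewrite n0// mulr0.
by rewrite mulr_ge0 ?G0// neg_part_ge0.
Qed.

Lemma integrable_moment phi : energy_space s 1 phi ->
  mu.-integrable setT (EFin \o (fun x => `|x| * phi x)).
Proof.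
move=> [cp p0 _]; apply: (@integrable_compact_support _ 1).
  by apply: continuousM => //; exact: continuous_normr.
by move=> x /p0 ->; rewrite mulr0.
Qed.

(** Because [x |-> `|x|] is homogeneous, the dilated solution solves the same equation in
    (-1, 1) up to the factor [`|l| ^ (1 + 2 * s)]. *)
Lemma solves_norm_dilation u l phi : solves s (fun x => `|x|) u ->
  l != 0 -> `|l| <= 1 -> energy_space s 1 phi ->
  gamma_const s / 2 * form s (fun x => u (l * x)) phi =
  `|l| `^ (1 + 2 * s) * \int[mu]_x (`|x| * phi x).
Proof.
move=> hu l0 l1 ep.
rewrite (solves_dilation hu continuous_normr)//.
have -> : \int[mu]_x (`|l * x| * phi x) = `|l| * \int[mu]_x (`|x| * phi x).
  rewrite -RintegralZl//; last exact: integrable_moment.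
  by apply: eq_Rintegral => x _; rewrite normrM mulrA.
have nl : 0 < `|l| by rewrite normr_gt0.
by rewrite (powRD_gt0 _ _ nl) powRr1// mulrA; congr (_ * _); rewrite mulrC.
Qed.

(** The difference [u (l * x) - `|l| ^ (1 + 2 * s) * u x] is nonnegative outside (-1, 1) and has
    a zero right-hand side inside.  Applied with [l = -1] this gives that [u] is even, and
    with [l] close to 1 that [u] almost decreases with [`|x|]. *)
Lemma dilation_le u l : 0 < gamma_const s -> solves s (fun x => `|x|) u ->
  l != 0 -> `|l| <= 1 -> forall x, `|l| `^ (1 + 2 * s) * u x <= u (l * x).
Proof.
move=> g0 hu l0 l1 x; rewrite -subr_ge0; move: x.
have u0 := solves_ge0 g0 hu (fun x _ => normr_ge0 x).
have [eu h] := hu; have [_ u1 _] := eu.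
pose c := `|l| `^ (1 + 2 * s).
have el := energy_dilation l0 eu.
have eW := energy_sub c el eu.
have W0 x : 1 <= `|x| -> 0 <= u (l * x) - c * u x.
  by move=> /u1 ->; rewrite mulr0 subr0.
apply: (weak_maximum_principle s0 eW W0).
have en := energy_neg_part eW W0.
have g2 : 0 < gamma_const s / 2 by rewrite divr_gt0.
rewrite -(pmulr_rge0 _ g2) (form_subl _ el eu en) mulrBr.
rewrite (solves_norm_dilation hu l0 l1 en) mulrCA (h _ en).
by rewrite /c subrr.
Qed.

Lemma form_sym w phi : form s w phi = form s phi w.
Proof. by apply: eq_Rintegral => z _; rewrite /dform mulrAC [RHS]mulrAC; ring. Qed.

Lemma mass_vanish phi : (forall x, 1 <= `|x| -> phi x = 0) ->
  \int[mu]_x (\1_(`]-1, 1[) x * phi x) = \int[mu]_x phi x.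
Proof.
move=> p0; apply: eq_Rintegral => x _; rewrite ind_int.
by have [x1|/p0 ->] := ltP `|x| 1; rewrite ?mul1r ?mulr0.
Qed.

Lemma neg_part_anti (A B : R) : (A - B) * (Num.max (- A) 0 - Num.max (- B) 0) <= 0.
Proof.
case: (lerP 0 (- A)) => ha; case: (lerP 0 (- B)) => hb.
- have -> : - A - - B = - (A - B) by ring.
  by rewrite mulrN oppr_le0 -expr2 sqr_ge0.
- by rewrite subr0 mulr_le0_ge0//; lra.
- by rewrite mulr_ge0_le0//; lra.
- by rewrite subrr mulr0.
Qed.

(** A barrier argument.  For [r = x1 / 3], [dilation_le] bounds [u (r * y)] below for [y] in
    [2, 3].  These values, seen from (-1, 1), make [u (r * x)] a supersolution with a
    right-hand side large enough to lift it above a small multiple [e] of the torsion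
    function.  The maximum principle is run by hand, because the contribution of
    [2, 3] has to compensate the right-hand side [e] of that multiple. *)
Lemma solution_gt0_at0 u x1 : 0 < gamma_const s -> solves s (fun x => `|x|) u ->
  0 < x1 < 1 -> 0 < u x1 -> 0 < u 0.
Proof.
have s0p : 0 < s := s0.
move=> g0 hu /andP[x0 x11] ux1.
have u0 := solves_ge0 g0 hu (fun x _ => normr_ge0 x).
have [eu _] := hu.
pose r := x1 / 3.
have r0 : 0 < r by rewrite divr_gt0.
have r1 : `|r| <= 1 by rewrite gtr0_norm// /r; lra.
have rn0 : r != 0 by rewrite gt_eqF.
pose c := (2 / 3) `^ (1 + 2 * s) * u x1.
have c0 : 0 < c by rewrite mulr_gt0// powR_gt0.
have uc y : 2 <= y <= 3 -> c <= u (r * y).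
  move=> /andP[y2 y3].
  have -> : r * y = (y / 3) * x1 by rewrite /r; field.
  have y0 : 0 < y / 3 by lra.
  apply: le_trans (dilation_le g0 hu _ _ _); [|by rewrite gt_eqF|by rewrite gtr0_norm//; lra].
  rewrite gtr0_norm// ler_wpM2r// ge0_ler_powR ?nnegrE//; lra.
pose C : R := 4 `^ (1 + 2 * s).
have C0 : 0 < C by exact: powR_gt0.
have k0 : 0 <= kappa s by exact: kappa_ge0.
(* such that the factor [C / c * (2 * e * kappa s)] met below is at most [1 / 2] *)
pose e := c / (4 * C * (kappa s + 1)).
have e0 : 0 < e by rewrite divr_gt0// !mulr_gt0//; lra.
have el := energy_dilation rn0 eu.
have eT := torsion_energy s01.
have eW := energy_sub e el eT.
pose W x := u (r * x) - e * torsion s x.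
have W0 x : 1 <= `|x| -> 0 <= W x.
  by move=> h; rewrite /W torsion_eq0// mulr0 subr0.
have en := energy_neg_part eW W0; have [cn n0 _] := en.
have i1 := integrable_dform eW en.
pose phi := neg_part W.
have phi0 x : 0 <= phi x by exact: neg_part_ge0.
have lowerb : - (2 * e * kappa s) * \int[mu]_x phi x <= form s W phi.
  rewrite (form_subl _ el eT en) [form s (torsion s) _]form_sym.
  rewrite (form_torsion s01 en)// interaction_eq0// subr0 mass_vanish//.
  have : 0 <= form s (fun x => u (r * x)) phi.
    have g2 : 0 < gamma_const s / 2 by rewrite divr_gt0.
    rewrite -(pmulr_rge0 _ g2) (solves_norm_dilation hu rn0 r1 en).
    by rewrite mulr_ge0 ?powR_ge0//; apply: Rintegral_ge0 => x _; rewrite mulr_ge0.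
  rewrite -/phi; set A := form _ _ _; set I := Rintegral _ _ _; set k := kappa s.
  by clearbody A I k e; nra.
have upperb : \int[mu]_x phi x <= - (C / c) * form s W phi.
  rewrite -RintegralZl//; apply: le_Rintegral_strip => //.
    exact: (integrableZl measurableT (- (C / c)) i1).
  move=> [x y]/=.
  have mono : (W x - W y) * (phi x - phi y) <= 0.
    exact: neg_part_anti.
  have q0 : 0 <= - (C / c) * dform s W phi (x, y).
    rewrite mulNr -mulrN mulr_ge0// ?divr_ge0 ?(ltW C0) ?(ltW c0)//.
    by rewrite oppr_ge0 mulr_le0_ge0// kern_ge0.
  rewrite indicE mem_itv in_itv/=; have [y23|_] := boolP (2 <= y <= 3); last by rewrite mulr0.
  have [xl|xl] := ltP `|x| 1; last by rewrite /phi n0// mul0r.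
  have y1 : 1 <= `|y|.
    by have /andP[y2 _] := y23; rewrite ger0_norm; clear -y2; lra.
  have Wy : c <= W y by rewrite /W torsion_eq0// mulr0 subr0 uc.
  have phiy : phi y = 0 by rewrite /phi n0.
  rewrite mulr1 /dform/= phiy subr0.
  have [px|px] := eqVneq (phi x) 0; first by rewrite px !(mulr0, mul0r).
  have Wx : W x = - phi x.
    move: px; rewrite /phi /neg_part; case: (lerP 0 (- W x)) => ha; first by rewrite opprK.
    by rewrite eqxx.
  rewrite Wx; have pp : 0 <= phi x by [].
  have K1 := kern_strip s0 xl y23; rewrite -/C in K1.
  have Kge := kern_ge0 s (x, y).
  have -> : - (C / c) * ((- phi x - W y) * phi x * kern s (x, y)) =
     (C * kern s (x, y)) * (phi x * ((phi x + W y) / c)) by ring.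
  have h1 : 1 <= (phi x + W y) / c by rewrite ler_pdivlMr//; lra.
  have h2 : phi x <= phi x * ((phi x + W y) / c) by rewrite ler_peMr.
  apply: (le_trans h2); rewrite ler_peMl//.
  by apply: le_trans h2.
have I0 : \int[mu]_x phi x <= 0.
  have h : - (C / c) * form s W phi <= (C / c) * (2 * e * kappa s) * \int[mu]_x phi x.
    rewrite !mulNr -mulrN -mulrA ler_wpM2l ?divr_ge0 ?(ltW C0) ?(ltW c0)//.
    by rewrite lerNl -mulNr.
  have hk : (C / c) * (2 * e * kappa s) <= 2^-1.
    have -> : (C / c) * (2 * e * kappa s) = 2^-1 * (kappa s / (kappa s + 1)).
      by rewrite /e; field; rewrite !gt_eqF//; lra.
    rewrite ler_piMr// ler_pdivrMr; lra.
  have I1 : 0 <= \int[mu]_x phi x by apply: Rintegral_ge0.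
  move: I1 h upperb hk; set A := - _ * _; set I := Rintegral _ _ _; set k := _ * (2 * e * _).
  by clearbody A I k; nra.
have phi_0 := Rintegral_continuous_le0 cn phi0 n0 I0.
have := phi_0 0; rewrite /phi /neg_part.
have : - W 0 <= Num.max (- W 0) 0 by rewrite le_max lexx.
move=> /[swap] ->; rewrite oppr_le0 /W mulr0 subr_ge0; apply: lt_le_trans.
by rewrite mulr_gt0// torsionE ?normr0// powR_gt0// abs_lt1// normr0.
Qed.

End solutions.

(** * The rearrangement *)

Section rearrangement.
Context {R : realType}.
Local Notation mu := (@lebesgue_measure R).
Implicit Types (x y t : R) (u : R -> R).

(** By continuity the bound persists on a slightly longer interval, which makes the
    inequality for the measure strict, as the definition of the rearrangement asks. *)
Lemma distribution_ge u t r : r < 1 -> (forall y, `|y| <= r -> t < `|u y|) ->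
  continuous u -> 0 <= r -> ((2 * r)%:E < distribution_fun u t)%E.
Proof.
move=> r1 ut cu r0.
have oV : open [set y | t < `|u y|].
  have -> : [set y | t < `|u y|] = (fun y => `|u y|) @^-1` [set z | t < z] by [].
  apply: open_comp; last exact: open_gt.
  move=> y _; apply: (@continuous_comp _ _ _ u Num.norm); first exact: cu.
  exact: norm_continuous.
have nb y : `|y| <= r -> exists2 e, 0 < e & forall y', `|y - y'| < e -> t < `|u y'|.
  move=> yr; have [/= e e0 he] : nbhs y [set y | t < `|u y|].
    by apply: open_nbhs_nbhs; split => //; exact: ut.
  by exists e => // y' h; exact: he.
have rr : `|r| <= r by rewrite ger0_norm.
have [e1 e10 h1] := nb r rr.
have [e2 e20 h2] := nb (- r) (eq_ind_r (fun t => t <= r) rr (normrN r)).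
pose e := Num.min (1 - r) (Num.min e1 e2).
have e0 : 0 < e by rewrite !lt_min subr_gt0 r1 e10.
have [er [ee1 ee2]] : e <= 1 - r /\ e <= e1 /\ e <= e2.
  by rewrite /e !ge_min !lexx/= !orbT.
have sub : (`](- (r + e))%R, (r + e)%R[%classic : set R) `<=` [set x | t < `|(u \_ `]-1, 1[) x| ].
  move=> y /=; rewrite in_itv/= => /andP[y1 y2].
  rewrite patchE mem_set; last by rewrite /= in_itv/=; lra.
  have [yr|] := leP `|y| r; first exact: ut.
  rewrite ltr_normr => /orP[yr|yr].
  - by apply: h1; rewrite ltr0_norm; lra.
  - by apply: h2; rewrite gtr0_norm; lra.
have cE : [set x | t < `|(u \_ `]-1, 1[) x| ] = (fun x => `|(u \_ `]-1, 1[) x|) @^-1` `]t, +oo[%classic.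
  by apply/seteqP; split => x /=; rewrite in_itv/= andbT.
have mu_u : measurable_fun setT (fun x => `|(u \_ `]-1, 1[) x|).
  apply: measurableT_comp => //.
  have mu0 : measurable_fun setT u by exact: continuous_measurable.
  apply/(measurable_restrictT u (measurable_itv `]-1, 1[)).
  exact: measurable_funS mu0.
have mV : measurable [set x | t < `|(u \_ `]-1, 1[) x| ].
  by rewrite cE -[X in measurable X]setTI; apply: mu_u => //; exact: measurable_itv.
apply: (@lt_le_trans _ _ (mu `](- (r + e))%R, (r + e)%R[)).
  by rewrite lebesgue_measure_itv/= lte_fin ifT; [rewrite -EFinB lte_fin; lra|lra].
by apply: le_measure; rewrite ?inE.
Qed.

(** All levels below [t0] belong to the set of which the rearrangement is the supremum, and
    the bound on [u] makes this set bounded. *)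
Lemma schwarz_ge u x t0 M : continuous u -> (forall y, `|u y| <= M) ->
  `|x| < 1 -> 0 < t0 -> (forall y, `|y| <= `|x| -> t0 <= u y) -> t0 <= schwarz u x.
Proof.
move=> cu uM x1 t00 ut.
have M0 : 0 <= M by apply: le_trans (uM 0).
have inS t : 0 <= t < t0 -> 0 <= t /\ ((2 * `|x|)%:E < distribution_fun u t)%E.
  move=> /andP[t0' tt]; split => //; apply: distribution_ge => // y yx.
  by apply: (lt_le_trans tt); apply: le_trans (ut y yx) _; exact: ler_norm.
have hub : has_ubound [set t | 0 <= t /\ ((2 * `|x|)%:E < distribution_fun u t)%E].
  exists M => t [t0' h]; rewrite leNgt; apply/negP => Mt.
  move: h; rewrite /distribution_fun.
  have -> : [set x | t < `|(u \_ `]-1, 1[) x| ] = set0.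
    apply/seteqP; split => // y /=; rewrite patchE; case: ifPn => _.
      by rewrite ltNge (le_trans (uM y) (ltW Mt)).
    by rewrite normr0 ltNge t0'.
  by rewrite measure0 lte_fin ltNge mulr_ge0.
apply/ler_addgt0Pr => e e0.
pose t := Num.max 0 (t0 - e / 2).
have tt : 0 <= t < t0.
  by rewrite /t le_max lexx/= gt_max t00/=; lra.
have := ub_le_sup hub (inS _ tt); rewrite -/(schwarz u x) => h.
have : t0 - e / 2 <= t by rewrite /t le_max lexx orbT.
lra.
Qed.

Lemma distribution_norm t : 0 <= t < 1 ->
  distribution_fun (fun x : R => `|x|) t = (2 * (1 - t))%:E.
Proof.
move=> /andP[t0 t1]; rewrite /distribution_fun.
have -> : [set x : R | t < `|((fun x : R => `|x|) \_ `]-1, 1[) x| ] =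
    (`](-1)%R, (- t)%R[%classic : set R) `|` (`]t, 1%R[%classic : set R).
  apply/seteqP; split => x /=; rewrite patchE.
  - case: ifPn; last by rewrite normr0; lra.
    rewrite inE/= in_itv/= normr_id ltr_normr => /andP[x1 x2] /orP[h|h].
    + by right; rewrite in_itv/= h.
    + by left; rewrite in_itv/= x1; lra.
  - rewrite !in_itv/= => -[/andP[h1 h2]|/andP[h1 h2]].
    + rewrite mem_set; last by rewrite /= in_itv/=; lra.
      by rewrite normr_id ltr_normr; apply/orP; right; lra.
    + rewrite mem_set; last by rewrite /= in_itv/=; lra.
      by rewrite normr_id ltr_normr h1.
rewrite measureU//; [|apply/seteqP; split => // x /=; rewrite !in_itv/=; lra].
have e1 : mu (`](-1)%R, (- t)%R[%classic : set R) = (1 - t)%:E.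
  by rewrite lebesgue_measure_itv/= lte_fin ltrN2 t1 -EFinB; congr EFin; ring.
have e2 : mu (`]t, 1%R[%classic : set R) = (1 - t)%:E.
  by rewrite lebesgue_measure_itv/= lte_fin t1 -EFinB.
transitivity ((1 - t)%:E + (1 - t)%:E)%E; first by congr (_ + _)%E.
by rewrite -EFinD; congr EFin; ring.
Qed.

Lemma schwarz_norm x : `|x| < 1 -> schwarz (fun x : R => `|x|) x = 1 - `|x|.
Proof.
move=> x1; rewrite /schwarz.
have x0 : 0 <= `|x| by [].
pose f (y : R) : R := `|y|.
have -> : [set t | 0 <= t /\ ((2 * `|x|)%:E < distribution_fun f t)%E] = `[0, (1 - `|x|)[%classic.
  apply/seteqP; split => t /=; rewrite in_itv/=.
  - move=> [t0]; have [t1|t1] := ltP t 1.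
      by rewrite distribution_norm ?t0// lte_fin => h; lra.
    rewrite /distribution_fun; have -> : [set x : R | t < `|((fun x : R => `|x|) \_ `]-1, 1[) x| ] = set0.
      apply/seteqP; split => // y /=; rewrite patchE; case: ifPn.
        by rewrite inE/= in_itv/= -ltr_norml normr_id; lra.
      by rewrite normr0; lra.
    by rewrite measure0 lte_fin; lra.
  - by move=> /andP[t0 t1]; split => //; rewrite distribution_norm ?lte_fin; lra.
by rewrite real_interval.sup_itv// bnd_simp; lra.
Qed.

End rearrangement.

(** * Moments of the torsion function *)

Section moments.
Context {R : realType}.
Local Notation mu := (@lebesgue_measure R).
Variables (s : R).
Hypotheses (s01 : 0 < s < 1).
Let s0 : 0 < s. Proof. by case/andP: s01. Qed.
Let s1 : s < 1. Proof. by case/andP: s01. Qed.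
Implicit Types (x y : R) (f : R -> R).

Lemma is_derive_pos_powR r x : 0 < x ->
  is_derive x 1 (pos_powR r) (r * x `^ (r - 1)).
Proof.
move=> x0; apply: (near_eq_is_derive _ (is_derive1_powR r x0)).
near=> y; rewrite pos_powRE// ltW//.
by near: y; exact: lt_nbhsr.
Unshelve. all: by end_near. Qed.

Lemma is_derive_gt0_lt (H dH : R -> R) (a b : R) : a < b ->
  {within `[a, b], continuous H} ->
  (forall x, a < x < b -> is_derive x 1 H (dH x)) ->
  (forall x, a < x < b -> 0 < dH x) -> H a < H b.
Proof.
move=> ab cH dHH dH0.
apply: (gtr0_derive1_lt_cc (a := a) (b := b)) => //.
- by move=> x; rewrite in_itv/= => /dHH[].
- by move=> x; rewrite in_itv/= => h; rewrite (is_derive1E (dHH x h)) dH0.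
- by rewrite in_itv/= lexx ltW.
- by rewrite in_itv/= lexx ltW.
Qed.

Lemma even_integral f : continuous f -> (forall x, 0 <= f x) ->
  (forall x, f (- x) = f x) -> (forall x, 1 <= `|x| -> f x = 0) ->
  \int[mu]_x f x = 2 * \int[mu]_(x in `[0, 1]) f x.
Proof.
move=> cf f0 fN f1.
have mf := continuous_measurable cf.
have h : (\int[mu]_x (f x)%:E = 2%:E * \int[mu]_(x in `[0%R, +oo[) (f x)%:E)%E.
  rewrite set_itvcy; apply: ge0_symfun_integralT => // x.
  by rewrite /= fN.
have e : (\int[mu]_(x in `[0%R, +oo[) (f x)%:E = \int[mu]_(x in `[0%R, 1%R]) (f x)%:E)%E.
  rewrite integral_mkcond [RHS]integral_mkcond; apply: eq_integral => x _.
  rewrite !patchE !mem_itv !in_itv/= andbT.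
  case: (leP 0 x) => //= x0; case: (leP x 1) => // x1.
  by rewrite f1// ger0_norm// ltW.
have i : mu.-integrable `[0, 1] (EFin \o f).
  by apply: continuous_compact_integrable; [exact: segment_compact|exact: continuous_subspaceT].
rewrite /Rintegral h e fineM//.
exact: (integrable_fin_num _ i).
Qed.

Lemma moment1E : \int[mu]_x (`|x| * torsion s x) = (s + 1)^-1.
Proof.
rewrite even_integral; last 4 first.
- by apply: continuousM; [exact: continuous_normr|exact: torsion_continuous].
- by move=> x; rewrite mulr_ge0 ?torsion_ge0.
- by move=> x; rewrite normrN torsionN.
- by move=> x x1; rewrite torsion_eq0// mulr0.
have sp : 0 < s + 1 by rewrite addr_gt0.
pose F x : R := - (2 * (s + 1))^-1 * pos_powR (s + 1) (1 - x ^+ 2).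
have cF : continuous F.
  move=> x; apply: cvgMr; exact: (@torsion_continuous R (s + 1) sp x).
have dF x : 0 < x < 1 -> is_derive x 1 F (x * torsion s x).
  move=> /andP[x0 x1].
  have xa : `|x| < 1 by rewrite gtr0_norm.
  have a0 := abs_lt1 xa.
  have d1 := is_derive_pos_powR (s + 1) a0.
  have e1 : is_derive x 1 (fun x : R => 1 - x ^+ 2) (- (2 * x)).
    by apply: is_derive_eq; rewrite /GRing.scale/=; ring.
  have c1 := @is_derive1_comp _ (pos_powR (s + 1)) (fun x : R => 1 - x ^+ 2) x _ _ d1 e1.
  have -> : F = (- (2 * (s + 1))^-1) \*: (pos_powR (s + 1) \o (fun x : R => 1 - x ^+ 2)) by [].
  apply: is_derive_eq.
  rewrite torsionE//; have -> : s + 1 - 1 = s by ring.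
  by rewrite /GRing.scale/=; field; rewrite gt_eqF.
have LR : derivable_oo_LRcontinuous F 0 1.
  split; [|apply: cvg_at_right_filter; exact: cF|apply: cvg_at_left_filter; exact: cF].
  by move=> x; rewrite in_itv/= => /dF[].
have := @continuous_FTC2 _ (fun x => x * torsion s x) F 0 1 ltr01 _ LR.
have -> : \int[mu]_(x in `[0, 1]) (`|x| * torsion s x) = \int[mu]_(x in `[0, 1]) (x * torsion s x).
  by apply: eq_Rintegral => x; rewrite inE/= in_itv/= => /andP[x0 _]; rewrite ger0_norm.
rewrite /Rintegral => ->.
- rewrite /= /F expr1n subrr expr0n/= subr0 pos_powR_le0 ?gt_eqF// mulr0 pos_powRE// powR1.
  by field; rewrite gt_eqF.
- apply: continuous_subspaceT; apply: continuousM; last exact: torsion_continuous.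
  by move=> x; exact: cvg_id.
- by move=> x; rewrite in_itv/= => h; rewrite (is_derive1E (dF x h)).
Qed.

(** This strict inequality is what makes the comparison fail.  With
    [t = (1 + x) / (1 - x)] one has [1 - x ^+ 2 = (1 - x) ^+ 2 * t], and the Bernoulli inequality
    [t ^ s < 1 + s * (t - 1)] bounds [torsion s] on (0, 1) by the function
    [(1 - 2 * s) * (1 - x) ^ (2 * s) + 2 * s * (1 - x) ^ (2 * s - 1)], whose integral over (0, 1) is
    [2 / (1 + 2 * s)].  The primitive [G] of the latter is compared with the integral of
    the torsion function. *)
Lemma moment0_lt : (1 + 2 * s) * \int[mu]_x torsion s x < 4.
Proof.
have s0' := s0; have s1' := s1.
have cT : continuous (torsion s) by exact: torsion_continuous.
rewrite even_integral//; last 3 first.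
- by move=> x; exact: torsion_ge0.
- by move=> x; rewrite torsionN.
- by move=> x; exact: torsion_eq0.
have iT (t : R) : mu.-integrable `[0, t] (EFin \o torsion s).
  by apply: continuous_compact_integrable; [exact: segment_compact|exact: continuous_subspaceT].
pose I x : R := \int[mu]_(t in `[0, x]) torsion s t.
pose c : R := (1 - 2 * s) / (1 + 2 * s).
pose G x : R := - (c * pos_powR (1 + 2 * s) (1 - x)) - pos_powR (2 * s) (1 - x).
pose H x : R := G x - I x.
have sub1 : continuous (fun x : R => 1 - x).
  by move=> x; apply: cvgB; [exact: cvg_cst|exact: cvg_id].
have cp r : 0 < r -> continuous (fun x : R => pos_powR r (1 - x)).
  move=> r0 x; apply: (@continuous_comp _ _ _ (fun x : R => 1 - x) (pos_powR r)); first exact: sub1.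
  exact: continuous_pos_powR.
have cG : continuous G.
  move=> x; apply: cvgB; last by apply: cp; lra.
  by apply: cvgN; apply: cvgMr; apply: cp; lra.
have cH : {within `[0, 1], continuous H}.
  have hI := parameterized_integral_continuous (ltW (@ltr01 R)) (iT 1).
  move=> x; apply: cvgB; last exact: hI.
  by have := continuous_subspaceT cG; apply.
have dp r x : x < 1 -> is_derive x 1 (fun x : R => pos_powR r (1 - x)) (- (r * (1 - x) `^ (r - 1))).
  move=> x1; have h : 0 < 1 - x by lra.
  have d1 := is_derive_pos_powR r h.
  have e1 : is_derive x 1 (fun x : R => 1 - x) (- 1).
    by apply: is_derive_eq; rewrite add0r mul1r.
  have := @is_derive1_comp _ (pos_powR r) (fun x : R => 1 - x) x _ _ d1 e1.
  by rewrite /GRing.scale/= mulrN1.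
have dH x : 0 < x < 1 -> is_derive x 1 H
    ((1 - 2 * s) * (1 - x) `^ (2 * s) + 2 * s * (1 - x) `^ (2 * s - 1) - torsion s x).
  move=> /andP[x0 x1].
  have dI : is_derive x 1 I (torsion s x) by exact: is_derive_integral.
  have p1 := dp (1 + 2 * s) x x1; have p2 := dp (2 * s) x x1.
  have -> : H = - (c \*: (fun x => pos_powR (1 + 2 * s) (1 - x))) - (fun x => pos_powR (2 * s) (1 - x)) - I by [].
  apply: is_derive_eq.
  have -> : 1 + 2 * s - 1 = 2 * s by ring.
  rewrite /GRing.scale/= /c; field.
  by rewrite gt_eqF//; lra.
have Hlt : H 0 < H 1.
  apply: (@is_derive_gt0_lt H _ 0 1 ltr01 cH dH) => x x01.
    have /andP[x0 x1] := x01.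
    have xa : `|x| < 1 by rewrite gtr0_norm.
    rewrite torsionE//; set y := 1 - x.
    have y0 : 0 < y by rewrite /y; lra.
    have y1 : y < 1 by rewrite /y; lra.
    pose t := (2 - y) / y.
    have t1 : 1 < t by rewrite /t ltr_pdivlMr//; lra.
    have -> : 1 - x ^+ 2 = y ^+ 2 * t by rewrite /t /y; field; rewrite gt_eqF.
    rewrite powRM ?sqr_ge0 ?(ltW (lt_trans ltr01 t1))//.
    have -> : (y ^+ 2) `^ s = y `^ (2 * s) by rewrite -powR_mulrn ?(ltW y0)// -powRrM.
    have -> : y `^ (2 * s - 1) = y `^ (2 * s) / y.
      by rewrite (powRD_gt0 _ _ y0) powR_inv1// ltW.
    have h := bernoulli_powR_lt s01 t1.
    have Y0 : 0 < y `^ (2 * s) by exact: powR_gt0.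
    rewrite subr_gt0.
    have -> : (1 - 2 * s) * y `^ (2 * s) + 2 * s * (y `^ (2 * s) / y) = y `^ (2 * s) * (1 + s * (t - 1)).
      by rewrite /t; field; rewrite gt_eqF.
    by rewrite ltr_pM2l.
move: Hlt; rewrite /H /G subr0 subrr.
have -> : I 0 = 0 by rewrite /I set_itv1 Rintegral_set1.
have e1 r : pos_powR r (1 : R) = 1 by rewrite pos_powRE// powR1.
have e0 r : 0 < r -> pos_powR r (0 : R) = 0.
  by move=> r0; rewrite pos_powR_le0// gt_eqF.
rewrite !e1 !e0; [|lra|lra].
rewrite -/(I 1) => hh.
have h : I 1 < c + 1 by move: hh; set J := I 1; clearbody J c; lra.
have : (1 + 2 * s) * I 1 < (1 + 2 * s) * (c + 1).
  by rewrite ltr_pM2l; lra.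
have -> : (1 + 2 * s) * (c + 1) = 2 by rewrite /c; field; rewrite gt_eqF//; lra.
by lra.
Qed.

End moments.

(** * Boundary flux and comparison near the end points *)

Section conclusion.
Context {R : realType}.
Local Notation mu := (@lebesgue_measure R).
Variables (s : R).
Hypotheses (s01 : 0 < s < 1).
Let s0 : 0 < s. Proof. by case/andP: s01. Qed.
Implicit Types (x y r c : R) (u v w : R -> R).

Let kappa0 : 0 <= kappa s.
Proof. exact: kappa_ge0. Qed.

(** For [0 < r], the indicator function of the complement of (-r, r). *)
Definition layer r x : R := 1 - \1_(`]-1, 1[) (r^-1 * x).

(** By [fluxE] this measures the change of [form s w (torsion s)] under a dilation of [w], which
    the equation of [w] determines.  On the other hand the defining expression is increasing
    in [w] and involves only the values of [w] outside (-r, r): this transports the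
    comparison of [w] near the end points to the data. *)
Definition flux r w : R :=
  kappa s * \int[mu]_x (layer r x * w x) + r * interaction s (fun x => w (r * x)).

Lemma layerE r x : 0 < r -> layer r x = (r <= `|x|)%R%:R.
Proof.
move=> r0; rewrite /layer ind_int normrM normfV (gtr0_norm r0).
rewrite mulrC ltr_pdivrMr// mul1r ltNge.
by case: (r <= `|x|); rewrite /= ?subr0 ?subrr.
Qed.

Lemma measurable_layer r : measurable_fun setT (layer r).
Proof.
apply: measurable_funB => //.
have mi : measurable_fun setT (\1_(`]-1, 1[) : R -> R) by exact: measurable_indic.
by apply: (measurableT_comp mi).
Qed.

Lemma energy_Lebesgue_integrable b w : energy_space s b w ->
  mu.-integrable setT (EFin \o w).
Proof. by move=> [cw w0 _]; exact: integrable_compact_support cw w0. Qed.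

Lemma layer_integrable b r w : 0 < r -> energy_space s b w ->
  mu.-integrable setT (fun x => (layer r x * w x)%:E).
Proof.
move=> r0 ew; have iw := energy_Lebesgue_integrable ew.
apply: le_integrable iw => //.
  apply/measurable_EFinP; apply: measurable_funM; first exact: measurable_layer.
  exact: energy_measurable ew.
move=> x _ /=; rewrite lee_fin normrM layerE//.
by case: (r <= `|x|); rewrite /= ?normr1 ?normr0 ?mul1r ?mul0r.
Qed.

Lemma fluxE r w : 0 < r -> energy_space s 1 w -> (forall x, 0 <= w x) ->
  2 * flux r w = form s w (torsion s) - r * form s (fun x => w (r * x)) (torsion s).
Proof.
move=> r0 ew w0; have rn0 : r != 0 by rewrite gt_eqF.
have [cw w1 _] := ew.
have er := energy_dilation rn0 ew.
rewrite (form_torsion s01 ew w0) (form_torsion s01 er (fun x => w0 _)).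
rewrite interaction_eq0// subr0 mass_vanish//.
have iw := energy_Lebesgue_integrable ew.
have il := layer_integrable r0 ew.
have mr : r * \int[mu]_x (\1_(`]-1, 1[) x * w (r * x)) = \int[mu]_x w x - \int[mu]_x (layer r x * w x).
  have mF : measurable_fun setT (fun x => w x - layer r x * w x).
    apply: measurable_funB; first exact: energy_measurable ew.
    apply: measurable_funM; first exact: measurable_layer.
    exact: energy_measurable ew.
  have -> : \int[mu]_x (\1_(`]-1, 1[) x * w (r * x)) =
      \int[mu]_x (w (r * x) - layer r (r * x) * w (r * x)).
    by apply: eq_Rintegral => x _; rewrite /layer mulrA mulVf// mul1r; ring.
  rewrite (Rintegral_dilation rn0 mF) (gtr0_norm r0) mulrA mulfV// mul1r.
  by rewrite RintegralB.
rewrite /flux; set A := \int[mu]_x (layer r x * _) in mr *; set W := \int[mu]_x w x in mr *.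
set J := interaction _ _; set M := \int[mu]_x (_ * w (r * x)) in mr *; set k := kappa s.
have -> : A = W - r * M by rewrite mr; ring.
ring.
Qed.

Lemma energy_scale b c w : energy_space s b w -> energy_space s b (fun x => c * w x).
Proof.
move=> ew; have := energy_sub (1 - c) ew ew; rewrite maxxx.
have -> // : (fun x => w x - (1 - c) * w x) = (fun x => c * w x).
by apply/funext => x; ring.
Qed.

Lemma flux_le r c u v : 0 < r -> 0 <= c -> energy_space s 1 u -> energy_space s 1 v ->
  (forall x, 0 <= u x) -> (forall x, 0 <= v x) ->
  (forall x, r <= `|x| -> c * u x <= v x) -> c * flux r u <= flux r v.
Proof.
move=> r0 c0 eu ev u0 v0 uv; have rn0 : r != 0 by rewrite gt_eqF.
have eru := energy_dilation rn0 eu; have erv := energy_dilation rn0 ev.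
rewrite /flux mulrDr; apply: lerD.
  rewrite mulrCA ler_wpM2l// -RintegralZl//; last exact: layer_integrable eu.
  apply: le_Rintegral => //.
  - exact: (integrableZl measurableT c (layer_integrable r0 eu)).
  - exact: layer_integrable ev.
  - move=> x _; rewrite layerE//; have [rx|_] := boolP (r <= `|x|).
      by rewrite !mul1r uv.
    by rewrite !mul0r mulr0.
rewrite mulrCA ler_wpM2l ?(ltW r0)// -(interactionZ s01 c eru)//.
have ecu := energy_scale c eru.
apply: (interaction_le s01 ecu erv) => //.
- by move=> x; rewrite mulr_ge0.
- move=> x x1; apply: uv; rewrite normrM (gtr0_norm r0).
  by rewrite ler_peMr// ltW.
Qed.

(** If [u] vanishes somewhere in (0, 1), [dilation_le] makes it vanish from there on.
    Otherwise [u] is positive on (-1, 1), hence bounded below by some [m > 0] on [-r1, r1], where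
    [r1 ^ (1 + 2 * s) = c].  For [x] so close to the boundary that [u x <= m], the value
    [c * u x] is a lower bound of [u] on the whole interval of the [y] with [`|y| <= `|x|]: by the
    choice of [m] if [`|y| <= r1], by [dilation_le] otherwise.  Hence the rearrangement of [u] at
    [x] is at least [c * u x]. *)
Lemma near_boundary c u v : 0 < gamma_const s -> solves s (fun x => `|x|) u ->
  0 < c < 1 -> (forall x, 0 <= v x) -> continuous u ->
  (forall x, `|x| < 1 -> schwarz u x <= v x) ->
  exists r, [/\ 0 < r < 1, c <= r `^ (1 + 2 * s) & forall x, r <= `|x| -> c * u x <= v x].
Proof.
have s0' : 0 < s := s0.
move=> g0 hu /andP[c0 c1] v0 cu suv.
have u0 := solves_ge0 s01 g0 hu (fun x _ => normr_ge0 x).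
have [eu _] := hu; have [_ u1 _] := eu.
have D := dilation_le s01 g0 hu.
pose p := 1 + 2 * s.
have p0 : 0 < p by rewrite /p; lra.
pose r1 := c `^ p^-1.
have r1p : r1 `^ p = c by rewrite -powRrM mulVf ?gt_eqF// powRr1// ltW.
have r10 : 0 < r1 by exact: powR_gt0.
have r11 : r1 < 1.
  have -> : 1 = 1 `^ p^-1 :> R by rewrite powR1.
  by apply: gt0_ltr_powR; rewrite ?nnegrE ?invr_gt0 ?(ltW c0).
have cr r : r1 <= r -> c <= r `^ p.
  move=> rr; rewrite -r1p; apply: ge0_ler_powR; rewrite ?nnegrE ?(ltW p0) ?(ltW r10)//.
  exact: le_trans (ltW r10) rr.
have uN x : u (- x) = u x.
  have h y : u y <= u (- y).
    have l0 : (- 1 : R) != 0 by rewrite oppr_eq0 oner_eq0.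
    have l1 : `|- 1 : R| <= 1 by rewrite normrN normr1.
    by have := D _ l0 l1 y; rewrite normrN normr1 powR1 mul1r mulN1r.
  by apply/eqP; rewrite eq_le; have := h x; have := h (- x); rewrite opprK => -> ->.
have uabs x : u x = u `|x|.
  have [xx|xx] := boolP (0 <= x); first by rewrite ger0_norm.
  by rewrite ltr0_norm ?uN// ltNge.
have [[x1 [/andP[x10 x11] ux1]]|npos] := pselect (exists x1, 0 < x1 < 1 /\ u x1 = 0).
  exists (Num.max r1 x1); split.
  - by rewrite lt_max r10/= gt_max r11 x11.
  - by apply: cr; rewrite le_max lexx.
  - move=> x; rewrite ge_max => /andP[_ xx].
    have x0 : 0 < `|x| by apply: lt_le_trans xx.
    have xn0 : x != 0 by rewrite -normr_gt0.
    have := D (x1 / x) _ _ x; rewrite divfK// ux1 normrM normfV (gtr0_norm x10).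
    have l0 : x1 / x != 0 by rewrite mulf_neq0 ?invr_eq0// gt_eqF.
    have l1 : x1 / `|x| <= 1 by rewrite ler_pdivrMr// mul1r.
    move=> /(_ l0 l1); rewrite pmulr_rle0 ?powR_gt0 ?divr_gt0// => ux.
    have -> : u x = 0 by apply/eqP; rewrite eq_le ux u0.
    by rewrite mulr0.
have upos x : 0 < x < 1 -> 0 < u x.
  move=> x01; rewrite lt_neqAle u0 andbT; apply/eqP => ux; apply: npos.
  by exists x; split.
have u00 : 0 < u 0.
  have h : 0 < (2^-1 : R) < 1 by lra.
  exact: (solution_gt0_at0 s01 g0 hu h (upos _ h)).
have [m m0 mu1] : exists2 m, 0 < m & forall y, `|y| <= r1 -> m <= u y.
  have rr : - r1 <= r1 by lra.
  have [z zr hz] := EVT_min rr (continuous_subspaceT cu).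
  exists (u z); last by move=> y yr; apply: hz; rewrite in_itv/= -ler_norml.
  rewrite uabs; have [->|zn] := eqVneq z 0; first by rewrite normr0.
  apply: upos; rewrite normr_gt0 zn/=.
  by apply: le_lt_trans r11; rewrite ler_norml; move: zr; rewrite in_itv.
have [e e0 he] : exists2 e, 0 < e & forall y, `|1 - y| < e -> u y < m.
  have oV : open [set y | u y < m].
    have -> : [set y | u y < m] = u @^-1` [set t | t < m] by [].
    apply: open_comp; last exact: open_lt.
    by move=> y _; exact: cu.
  have [/= e e0 he] : nbhs (1 : R) [set y | u y < m].
    by apply: open_nbhs_nbhs; split => //=; rewrite u1 ?normr1.
  by exists e => // y h; exact: he.
exists (Num.max r1 (1 - e / 2)); split.
- by rewrite lt_max r10/= gt_max r11/=; lra.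
- by apply: cr; rewrite le_max lexx.
move=> x; rewrite ge_max => /andP[r1x ex].
have [x1|x1] := ltP `|x| 1; last by rewrite u1// mulr0.
have xpos : 0 < `|x| by apply: lt_le_trans r1x.
have ux0 : 0 < u x by rewrite uabs upos// xpos.
have uxm : u x <= m.
  by apply/ltW; rewrite uabs; apply: he; rewrite gtr0_norm; lra.
apply: le_trans (suv x x1).
have [M uM] := energy_bounded eu.
apply: (schwarz_ge cu uM x1); first by rewrite mulr_gt0.
move=> y yx; have [yr|yr] := leP `|y| r1.
  apply: le_trans (mu1 y yr); apply: le_trans uxm.
  by rewrite ler_piMl// ltW.
have xn0 : x != 0 by rewrite -normr_gt0.
have yn0 : y != 0 by rewrite -normr_gt0 (lt_trans r10).
have := D (y / x) _ _ x; rewrite divfK//.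
have l0 : y / x != 0 by rewrite mulf_neq0 ?invr_eq0.
have l1 : `|y / x| <= 1 by rewrite normrM normfV ler_pdivrMr// mul1r.
move=> /(_ l0 l1); apply: le_trans; rewrite ler_wpM2r// cr//.
rewrite normrM normfV ler_pdivlMr//; apply: le_trans (ltW yr).
by rewrite ler_piMr// ltW.
Qed.

End conclusion.

(** * The contradiction *)

Section comparison.
Context {R : realType}.
Local Notation mu := (@lebesgue_measure R).
Variables (s : R).
Hypotheses (s01 : 0 < s < 1).
Let s0 : 0 < s. Proof. by case/andP: s01. Qed.
Implicit Types (x r c : R) (u v : R -> R).

Let T := torsion s.
Let m0 : R := \int[mu]_x T x.
Let m1 : R := \int[mu]_x (`|x| * T x).

(** The form tested with the torsion function is known for [u] from its equation, and for
    the dilation of [u] from [solves_norm_dilation]. *)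
Lemma flux_distance r u : 0 < r < 1 -> 0 < gamma_const s -> solves s (fun x => `|x|) u ->
  gamma_const s * flux s r u = m1 * (1 - r * r `^ (1 + 2 * s)).
Proof.
move=> /andP[r0 r1] g0 hu; have [eu hT] := hu.
have u0 := solves_ge0 s01 g0 hu (fun x _ => normr_ge0 x).
have eT := torsion_energy s01.
have rn0 : r != 0 by rewrite gt_eqF.
have r1' : `|r| <= 1 by rewrite gtr0_norm// ltW.
have h1 := hT _ eT.
have h2 := solves_norm_dilation hu rn0 r1' eT.
have h3 := fluxE s01 r0 eu u0.
rewrite (gtr0_norm r0) in h2.
have -> : gamma_const s * flux s r u = gamma_const s / 2 * (2 * flux s r u) by field.
rewrite h3 mulrBr h1 mulrCA h2 -/T -/m1; ring.
Qed.

(** The data [1 - `|x|] is a sum of two homogeneous functions, of degrees 0 and 1; each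
    moment scales with its own power of [r]. *)
Lemma flux_codistance r v : 0 < r < 1 -> 0 < gamma_const s ->
  solves s (fun x => 1 - `|x|) v ->
  gamma_const s * flux s r v =
  m0 * (1 - r `^ (1 + 2 * s)) - m1 * (1 - r * r `^ (1 + 2 * s)).
Proof.
move=> /andP[r0 r1] g0 hv; have [ev hT] := hv.
have v0 : forall x, 0 <= v x.
  by apply: (solves_ge0 s01 g0 hv) => x x1; rewrite subr_ge0 ltW.
have eT := torsion_energy s01.
have rn0 : r != 0 by rewrite gt_eqF.
have r1' : `|r| <= 1 by rewrite gtr0_norm// ltW.
have cG : continuous (fun x : R => 1 - `|x|).
  by move=> x; apply: cvgB; [exact: cvg_cst|exact: continuous_normr].
have iT := energy_Lebesgue_integrable eT.
have iM := integrable_moment eT.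
have massE l : 0 <= l -> \int[mu]_x ((1 - `|l * x|) * T x) = m0 - l * m1.
  move=> l0; rewrite /m1 -RintegralZl// -RintegralB//; last exact: (integrableZl measurableT l iM).
  by apply: eq_Rintegral => x _; rewrite normrM (ger0_norm l0); ring.
have h1 := hT _ eT.
have h2 := solves_dilation hv cG rn0 r1' eT.
have h3 := fluxE s01 r0 ev v0.
have e1 : \int[mu]_x ((1 - `|x|) * T x) = m0 - m1.
  by rewrite -[m1]mul1r -massE//; apply: eq_Rintegral => x _; rewrite mul1r.
rewrite (gtr0_norm r0) massE ?(ltW r0)// in h2; rewrite e1 in h1.
have -> : gamma_const s * flux s r v = gamma_const s / 2 * (2 * flux s r v) by field.
rewrite h3 mulrBr h1 mulrCA h2 (powRD_gt0 _ _ r0) powRr1 ?ltW//; ring.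
Qed.

(** To first order in [1 - r], and for [c] close to 1, this is [(1 + 2 * s) * m0 < 4], as
    [m1 = (s + 1)^-1].  Bernoulli inequalities for the exponents [1 + 2 * s] at [r] and
    [2 + 2 * s] at [r^-1] give it with a loss [r ^ (1 + 2 * s) >= c], which explains the factor
    [c ^+ 2]. *)
Lemma moment_contradiction r c : 0 < r < 1 -> 0 < c < 1 -> c <= r `^ (1 + 2 * s) ->
  (1 + 2 * s) * m0 < 4 * c ^+ 2 ->
  m0 * (1 - r `^ (1 + 2 * s)) < (1 + c) * (m1 * (1 - r * r `^ (1 + 2 * s))).
Proof.
have s0' : 0 < s := s0.
move=> /andP[r0 r1] /andP[c0 c1] cr hm.
set P := r `^ (1 + 2 * s) in cr *.
have P0 : 0 < P by exact: powR_gt0.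
have m00 : 0 <= m0 by apply: Rintegral_ge0 => x _; exact: torsion_ge0.
have m1E : m1 = (s + 1)^-1 by exact: moment1E.
have b1 : 1 - P <= (1 + 2 * s) * (1 - r).
  have p1 : 1 <= 1 + 2 * s by lra.
  by have := bernoulli_powR_ge p1 (ltW r0); rewrite -/P; lra.
have b2 : 2 * (s + 1) * (1 - r) * P <= 1 - r * P.
  have p1 : 1 <= 1 + (1 + 2 * s) by lra.
  have ri : 0 <= r^-1 by rewrite invr_ge0 ltW.
  have := bernoulli_powR_ge p1 ri.
  have -> : r^-1 `^ (1 + (1 + 2 * s)) = (r * P)^-1.
    by rewrite -powR_inv1 ?(ltW r0)// -powRrM mulN1r powRN (powRD_gt0 _ _ r0) powRr1 ?(ltW r0).
  have rP : 0 < r * P by rewrite mulr_gt0.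
  rewrite -(ler_pM2l rP) mulfV ?gt_eqF// => h.
  have e : r * P * (1 + (1 + (1 + 2 * s)) * (r^-1 - 1)) = r * P + 2 * (s + 1) * (1 - r) * P.
    by field; rewrite gt_eqF.
  by rewrite e in h; lra.
have ps : 0 < s + 1 by lra.
rewrite m1E.
have h1 : m0 * (1 - P) <= m0 * ((1 + 2 * s) * (1 - r)) by rewrite ler_wpM2l.
have h2 : (1 + c) * (2 * (1 - r) * P) <= (1 + c) * ((s + 1)^-1 * (1 - r * P)).
  rewrite ler_wpM2l//; first by lra.
  by rewrite ler_pdivlMl//; apply: le_trans b2; rewrite !mulrA [(s + 1) * 2]mulrC.
apply: le_lt_trans h1 _; apply: lt_le_trans h2.
have -> : m0 * ((1 + 2 * s) * (1 - r)) = (1 - r) * ((1 + 2 * s) * m0) by ring.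
have -> : (1 + c) * (2 * (1 - r) * P) = (1 - r) * (2 * (1 + c) * P) by ring.
rewrite ltr_pM2l; last by lra.
apply: lt_le_trans hm _; nra.
Qed.

Lemma schwarz_not_le u v : weak_solution s (fun x => `|x|) u -> continuous u ->
  weak_solution s (schwarz (fun x => `|x|)) v -> continuous v ->
  exists2 x : R, x \in `]-1, 1[ & v x < schwarz u x.
Proof.
have s0' : 0 < s := s0.
move=> wu cu wv cv.
have hu : solves s (fun x => `|x|) u by exact: (weak_solution_solves wu).
have hv : solves s (fun x => 1 - `|x|) v.
  apply: (weak_solution_solves wv cv) => x; rewrite in_itv/= -ltr_norml.
  exact: schwarz_norm.
have g0 := gamma_const_gt0 s01 hu.
apply: contrapT => nex.
have suv x : `|x| < 1 -> schwarz u x <= v x.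
  move=> x1; rewrite leNgt; apply/negP => h; apply: nex; exists x => //.
  by rewrite in_itv/= -ltr_norml.
have u0 := solves_ge0 s01 g0 hu (fun x _ => normr_ge0 x).
have v0 : forall x, 0 <= v x.
  by apply: (solves_ge0 s01 g0 hv) => x x1; rewrite subr_ge0 ltW.
pose t : R := (1 + 2 * s) * m0 / 4.
have t1 : t < 1 by have := moment0_lt s01; rewrite -/T -/m0 /t; lra.
have t0 : 0 <= t.
  rewrite /t; have m00 : 0 <= m0 by apply: Rintegral_ge0 => x _; exact: torsion_ge0.
  by rewrite divr_ge0// mulr_ge0//; lra.
(* the mean of [t] and 1, so that [c ^+ 2 > t] by the inequality between the means *)
pose c := (1 + t) / 2.
have c01 : 0 < c < 1 by rewrite /c; lra.
have hc : (1 + 2 * s) * m0 < 4 * c ^+ 2.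
  have -> : (1 + 2 * s) * m0 = 4 * t by rewrite /t; field.
  by rewrite /c; nra.
have [r [r01 cr near]] := near_boundary s01 g0 hu c01 v0 cu suv.
have [r0 _] := andP r01; have [c0 _] := andP c01.
have le := flux_le s01 r0 (ltW c0) hu.1 hv.1 u0 v0 near.
have := moment_contradiction r01 c01 cr hc; apply/negP; rewrite -leNgt.
rewrite mulrDl mul1r -lerBrDl -(flux_codistance r01 g0 hv) -(flux_distance r01 g0 hu).
by rewrite mulrCA ler_wpM2l// ltW.
Qed.

End comparison.

Theorem mainTheorem4 (R : realType) :
  let f : R -> R := fun x => `|x| in
  (forall x : R, x \in `]-1, 1[ -> schwarz f x = 1 - `|x|) /\
  (forall (s : R) (u v : R -> R),
     0 < s < 1 ->
     weak_solution s f u -> continuous u ->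
     weak_solution s (schwarz f) v -> continuous v ->
     exists2 x : R, x \in `]-1, 1[ & v x < schwarz u x).
Proof.
move=> f; split; last first.
  move=> s u v s01 wu cu wv cv; exact: (schwarz_not_le s01 wu cu wv cv).
by move=> x; rewrite in_itv/= -ltr_norml; exact: schwarz_norm.
Qed.
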